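(* Let $(X_0,X_1)$ be a compatible couple and let $b\in SV(0,\infty)\cap AC(0,\infty)$ satisfy $$b\ \text{is strictly decreasing},\quad b(0)<\infty,\quad b(\infty)=0.$$ Let $\beta\in SV(0,\infty)\cap AC(0,\infty)$ be such that $$\beta\ \text{is strictly decreasing},\quad \beta(0)=\infty,\quad \beta(\infty)=0,$$ assume that $B\in SV(0,\infty)$ is given by $$B(x):=b(x)\ \text{ if } x\in[1,\infty),\qquad B(x):=c\,\beta(x)\ \text{ if } x\in(0,1),$$ where $c$ is a positive constant chosen in such a way that $B\in AC(0,\infty)$, and let $$A(x):=\frac{B^2(x)}{x(-B'(x))}\quad\text{for a.a. } x>0.$$ Then $$(X_0,X_1)_{0,\infty,b;K}=X_0+(X_0,X_1)_{0,\infty,B;K}=X_0+(X_0,X_1)_{0,\infty,A;J}.$$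
   Context: A pair $(X_0,X_1)$ of Banach spaces is a compatible couple if there is a Hausdorff topological vector space in which both $X_0$ and $X_1$ are continuously embedded. $X_0\cap X_1$ carries the norm $\max\{\|f\|_{X_0},\|f\|_{X_1}\}$; the sum $X+Y$ of two Banach spaces embedded in a common space carries the norm $\inf\{\|f_0\|_{X}+\|f_1\|_{Y}: f=f_0+f_1\}$. For $t>0$, $$K(f,t;X_0,X_1):=\inf\{\|f_0\|_{X_0}+t\|f_1\|_{X_1}: f=f_0+f_1,\ f_0\in X_0,\ f_1\in X_1\}\quad (f\in X_0+X_1),$$ $$J(f,t;X_0,X_1):=\max\{\|f\|_{X_0},t\|f\|_{X_1}\}\quad (f\in X_0\cap X_1).$$ $\|\cdot\|_{\infty,(c,d)}$ is the $L_\infty$-norm (essential supremum) on $(c,d)$. For a measurable non-negative weight $v$ on $(0,\infty)$: - $(X_0,X_1)_{0,\infty,v;K}$ is the set of $f\in X_0+X_1$ with $\|f\|_{0,\infty,v;K}:=\|v(t)K(f,t;X_0,X_1)\|_{\infty,(0,\infty)}<\infty$. - $(X_0,X_1)_{0,\infty,v;J}$ is the set of $f\in X_0+X_1$ for which there is a strongly measurable $u:(0,\infty)\to X_0\cap X_1$ with $f=\int_0^\infty u(s)\,\frac{ds}{s}$ (convergence in $X_0+X_1$) and for which $\|f\|_{0,\infty,v;J}:=\inf\|v(t)J(u(t),t;X_0,X_1)\|_{\infty,(0,\infty)}$ is finite, the infimum being over all such representations of $f$. The convention $a/0=\infty$ for $a\in(0,\infty)$ is used (and $0\cdot\infty=0$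 in the weighted norms). Equality of two spaces means that they are equal as sets and their norms are equivalent. $SV(0,\infty)$ is the set of slowly varying functions: positive, finite, Lebesgue-measurable functions $b$ on $(0,\infty)$ such that for each $\varepsilon>0$, $t^{\varepsilon}b(t)$ is equivalent to a non-decreasing function on $(0,\infty)$ and $t^{-\varepsilon}b(t)$ is equivalent to a non-increasing function on $(0,\infty)$ (two non-negative functions are equivalent if each is bounded by a positive constant multiple of the other). $AC(0,\infty)$ is the set of functions that are absolutely continuous on every compact subinterval of $(0,\infty)$. For monotone $f$ on $(0,\infty)$, $f(0):=\lim_{t\to0+}f(t)$ and $f(\infty):=\lim_{t\to\infty}f(t)$. *)

(* Defs.v *)
From HB Require Import structures.
From mathcomp Require Import all_boot all_order all_algebra.
From mathcomp Require Import all_classical all_reals all_analysis.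

Set Implicit Arguments.
Unset Strict Implicit.
Unset Printing Implicit Defensive.

Import Order.TTheory GRing.Theory Num.Theory.
Import numFieldNormedType.Exports.

Local Open Scope classical_set_scope.
Local Open Scope ring_scope.

Section Spaces.
Context {R : realType} {Z : topologicalLmodType R}.

(* A normed space sitting inside [Z], given by its set of elements and its norm.
   All constructions below give the value +oo to the norm outside [elts]. *)
Record nspace := NSpace {
  elts : set Z ;
  nrm : Z -> \bar R }.

Definition embedded {X : normedModType R} (i : X -> Z) : nspace :=
  NSpace (range i) (fun z => ereal_inf [set `|x|%:E | x in i @^-1` [set z]]).

Definition decomp (X Y : nspace) (f : Z) : set (Z * Z) :=
  [set p | [/\ elts X p.1, elts Y p.2 & f = p.1 + p.2]].

Definition cap_space (X Y : nspace) : nspace :=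
  NSpace (elts X `&` elts Y) (fun f => maxe (nrm X f) (nrm Y f)).

Definition sum_space (X Y : nspace) : nspace :=
  NSpace [set f | decomp X Y f !=set0]
    (fun f => ereal_inf [set (nrm X p.1 + nrm Y p.2)%E | p in decomp X Y f]).

Definition eq_space (X Y : nspace) : Prop :=
  elts X = elts Y /\
  exists c C : R, [/\ 0 < c, 0 < C &
    forall f, elts X f ->
      (c%:E * nrm X f <= nrm Y f)%E /\ (nrm Y f <= C%:E * nrm X f)%E].

Definition compatible_couple {X0 X1 : completeNormedModType R}
    (i0 : {linear X0 -> Z}) (i1 : {linear X1 -> Z}) : Prop :=
  [/\ hausdorff_space Z, injective i0 /\ continuous i0
    & injective i1 /\ continuous i1].

Definition Kfun (X Y : nspace) (f : Z) (t : R) : \bar R :=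
  ereal_inf [set (nrm X p.1 + t%:E * nrm Y p.2)%E | p in decomp X Y f].

Definition Jfun (X Y : nspace) (f : Z) (t : R) : \bar R :=
  maxe (nrm X f) (t%:E * nrm Y f)%E.

(* Simple functions are taken Borel measurable; as convergence is only required
   almost everywhere, this gives the usual (Lebesgue) strong measurability. *)
Definition simple_fun (E : nspace) (D : set R) (s : R -> Z) : Prop :=
  [/\ forall t, D t -> elts E (s t),
      finite_set (s @` D)
    & forall z, measurable (D `&` s @^-1` [set z])].

Definition strongly_measurable (E : nspace) (D : set R) (u : R -> Z) : Prop :=
  (forall t, D t -> elts E (u t)) /\
  exists s : nat -> R -> Z,
    (forall n, simple_fun E D (s n)) /\
    {ae lebesgue_measure, forall t, D t ->
       nrm E (s n t - u t) @[n --> \oo] --> 0%E}.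

Definition simple_integrable (D : set R) (s : R -> Z) : Prop :=
  forall z, z != 0 -> (lebesgue_measure (D `&` s @^-1` [set z]) < +oo)%E.

(* For z = 0 the measure may be infinite, but that term vanishes. *)
Definition simple_integral (D : set R) (s : R -> Z) : Z :=
  \sum_(z \in s @` D) fine (lebesgue_measure (D `&` s @^-1` [set z])) *: z.

(* [u] is Bochner integrable over [D] in [E], with integral [f]. The integrand
   `nrm E (u t - s n t)` need only be Lebesgue measurable, i.e. a.e. equal to a
   Borel function; \int, a supremum over Borel simple functions below the
   integrand, does not see null sets. *)
Definition has_bochner_integral (E : nspace) (D : set R) (u : R -> Z) (f : Z) :
    Prop :=
  [/\ strongly_measurable E D u, elts E f &
    exists s : nat -> R -> Z,
      [/\ forall n, simple_fun E D (s n) /\ simple_integrable D (s n),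
          (\int[lebesgue_measure]_(t in D) nrm E (u t - s n t)%R)%E
            @[n --> \oo] --> 0%E
        & nrm E (simple_integral D (s n) - f) @[n --> \oo] --> 0%E]].

Definition Linfty_norm (g : R -> \bar R) : \bar R :=
  ('N[lebesgue_measure]_+oo[g \_ `]0%R, +oo[])%E.

(* Weights may take the value +oo; in \bar R, 0 * +oo = 0. *)
Definition K0oo (X Y : nspace) (v : R -> \bar R) : nspace :=
  let N f := Linfty_norm (fun t => v t * Kfun X Y f t)%E in
  NSpace [set f | elts (sum_space X Y) f /\ (N f < +oo)%E]
    (fun f => if f \in elts (sum_space X Y) then N f else +oo%E).

Definition J_repr (X Y : nspace) (f : Z) (u : R -> Z) : Prop :=
  strongly_measurable (cap_space X Y) `]0, +oo[ u /\
  has_bochner_integral (sum_space X Y) `]0, +oo[ (fun s => s^-1 *: u s) f.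

Definition J0oo (X Y : nspace) (v : R -> \bar R) : nspace :=
  let N f := ereal_inf
    [set Linfty_norm (fun t => v t * Jfun X Y (u t) t)%E
      | u in [set u | J_repr X Y f u]] in
  NSpace [set f | [/\ elts (sum_space X Y) f, (exists u, J_repr X Y f u)
                    & (N f < +oo)%E]] N.

End Spaces.

Section Functions.
Context {R : realType}.
Implicit Types f g b : R -> R.

Definition equivalent_fun f g : Prop :=
  (exists2 c : R, 0 < c & forall t : R, 0 < t -> f t <= c * g t) /\
  (exists2 c : R, 0 < c & forall t : R, 0 < t -> g t <= c * f t).

Definition nondecreasing_pos g : Prop :=
  forall x y : R, 0 < x -> x <= y -> g x <= g y.

Definition nonincreasing_pos g : Prop :=
  forall x y : R, 0 < x -> x <= y -> g y <= g x.

Definition decreasing_pos g : Prop :=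
  forall x y : R, 0 < x -> x < y -> g y < g x.

Definition lebesgue_measurable_fun (D : set R) f : Prop :=
  forall Y : set R, measurable Y ->
    ((@wlength R idfun)^*)%mu.-cara.-measurable (D `&` f @^-1` Y).

Definition SV b : Prop :=
  [/\ forall t : R, 0 < t -> 0 < b t,
      lebesgue_measurable_fun `]0, +oo[ b
    & forall e : R, 0 < e ->
        (exists g, [/\ forall t : R, 0 < t -> 0 <= g t, nondecreasing_pos g
           & equivalent_fun (fun t => t `^ e * b t) g]) /\
        (exists g, [/\ forall t : R, 0 < t -> 0 <= g t, nonincreasing_pos g
           & equivalent_fun (fun t => t `^ (- e) * b t) g])].

Definition absolutely_continuous (x y : R) f : Prop :=
  forall e : R, 0 < e -> exists2 d : R, 0 < d &
    forall (n : nat) (l r : 'I_n -> R),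
      (forall i, [/\ x <= l i, l i <= r i & r i <= y]) ->
      trivIset setT (fun i => `]l i, r i[%classic) ->
      \sum_(i < n) (r i - l i) < d ->
      \sum_(i < n) `|f (r i) - f (l i)| < e.

Definition AC_pos f : Prop :=
  forall x y : R, 0 < x -> x <= y -> absolutely_continuous x y f.

(* Inverse in \bar R with 0^-1 = +oo, whence a / 0 = +oo for a > 0. *)
Definition J_weight (B : R -> R) (x : R) : \bar R :=
  ((B x ^+ 2)%:E / (x * - derive1 B x)%:E)%E.

End Functions.

(* Main.v *)
Require Import Defs.
From HB Require Import structures.
From mathcomp Require Import all_boot all_order all_algebra.
From mathcomp Require Import all_classical all_reals all_analysis.
From mathcomp Require Import measurable_realfun ess_sup_inf lra ring.
Import Order.TTheory GRing.Theory Num.Theory.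
Import numFieldNormedType.Exports.
Local Open Scope classical_set_scope.
Local Open Scope ring_scope.

(** The corollary is a cycle of three continuous inclusions,

      (X0, X1)_(0,oo,b;K)  into  X0 + (X0, X1)_(0,oo,A;J)
                           into  X0 + (X0, X1)_(0,oo,B;K)
                           into  (X0, X1)_(0,oo,b;K),

    proved in [K_space_le_sum_J], [J_space_le_K] (with [sum_space_le]) and
    [sum_K_space_le_K]. Going round the cycle gives both equivalences of norms.
    Almost everywhere A(t) = 1 / (t (1/B)'(t)), so the J-weight is governed by
    the nondecreasing, locally absolutely continuous function 1/B.

    First inclusion. As B decreases continuously to 0 on [1, oo), there are
    points x_k >= 1 with B(x_k) = 2^-k B(1). If the K-norm of f is less than M,
    then f = p_k + q_k with |p_k|_X0 + x_k |q_k|_X1 at most 2 M / B(x_k). Since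
    q_k tends to 0 in X1, f = p_1 + q_1 with q_1 the sum over k >= 1 of
    q_k - q_(k+1), which is also p_(k+1) - p_k. This vector is spread over the
    interval ]x_(k-1), x_k] with density proportional to (1/B)', so that
    u(t) is t (1/B)'(t) times a multiple of it. On that interval t <= x_k, whence
    J(u(t), t) <= 12 M t (1/B)'(t), which is the required bound. Slow variation
    makes x_k grow like 4^k, so the integral of u converges absolutely.

    Second inclusion. K(., t) is a seminorm on X0 + X1, hence K(f, t) is at most
    the integral of K(u(s), t) ds/s ([nrm_bochner_le]), and
    K(u(s), t) <= min(1, t/s) J(u(s), s) <= N min(1, t/s) s (1/B)'(s). Over s <= t
    the integral of (1/B)' is at most 1/B(t). Over s > t slow variation gives
    t/s <= K B(s)^2 / B(t)^2, and (1/B)' B^2 = -B' has integral at most B(t). The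
    sum is a constant multiple of N / B(t).

    Third inclusion. b is bounded and is dominated by a multiple of B.

    Two tools carry the analysis. [AC_density]: a monotone, locally absolutely
    continuous function is the integral of its almost everywhere derivative.
    [layered_bochner_integral]: a function h(t) v_k(t), where h is a scalar
    density and the index k(t) has measurable level sets, is Bochner integrable
    as soon as the masses of the layers make the series of the v_k absolutely
    convergent. *)

(** * Monotone absolutely continuous functions *)

Section density.
Set Implicit Arguments.
Unset Strict Implicit.
Context {R : realType}.
Implicit Types (F : R -> R) (a b x y : R).
Local Notation mu := (@lebesgue_measure R).

Lemma ae_lebesgueS (P Q : R -> Prop) : (forall t, P t -> Q t) ->
  {ae mu, forall t, P t} -> {ae mu, forall t, Q t}.
Proof. by move=> PQ; apply: filterS; first exact: (ae_filter_ringOfSetsType mu). Qed.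

Lemma ae_lebesgueS2 (P Q S : R -> Prop) : (forall t, P t -> Q t -> S t) ->
  {ae mu, forall t, P t} -> {ae mu, forall t, Q t} -> {ae mu, forall t, S t}.
Proof.
by move=> PQS; apply: filterS2; first exact: (ae_filter_ringOfSetsType mu).
Qed.

Lemma stieltjes_itv_oc (G : cumulative R R) x y : x <= y ->
  lebesgue_stieltjes_measure G `]x, y]%classic = (G y - G x)%:E.
Proof.
move=> xy; rewrite /lebesgue_stieltjes_measure /measure_extension.
by rewrite measurable_mu_extE/= ?wlength_itv_bnd//; exact: is_ocitv.
Qed.

Lemma open_interval_finite_measure (I : set R) : open I -> is_interval I ->
  (mu I < +oo)%E -> exists l r, l <= r /\ I = `]l, r[%classic.
Proof.
move=> oI iI Ifin.
have [->|/set0P[x Ix]] := eqVneq I set0.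
  by exists 0, 0; rewrite set_itvoo0.
have mI : measurable I by exact: open_measurable.
have ubI : has_ubound I.
  apply: contrapT => /has_ubPn ub.
  have : (mu `]x, +oo[%classic <= mu I)%E.
    apply: le_measure; rewrite ?inE//.
    move=> y /=; rewrite in_itv/= andbT => xy.
    have [z Iz yz] := ub y.
    by apply: (iI x z) => //; rewrite (ltW xy) ltW.
  by rewrite lebesgue_measure_itv/= ltry leNgt Ifin.
have lbI : has_lbound I.
  apply: contrapT => /has_lbPn lb.
  have : (mu `]-oo, x[%classic <= mu I)%E.
    apply: le_measure; rewrite ?inE//.
    move=> y /=; rewrite in_itv/= => xy.
    have [z Iz yz] := lb y.
    by apply: (iI z x) => //; rewrite (ltW xy) ltW.
  by rewrite lebesgue_measure_itv/= ltNyr leNgt Ifin.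
exists (inf I), (sup I); split.
  by apply: le_trans (ge_inf lbI Ix) (ub_le_sup ubI Ix).
transitivity (I^°); first exact/esym/interior_id.
by rewrite interval_bounded_interior.
Qed.

(** A Lebesgue-null set lies in an open set of small measure. The components of
    that open set are disjoint intervals, so absolute continuity bounds the
    Stieltjes measure of every finite subfamily, hence of their union. *)
Lemma stieltjes_dominated (G : cumulative R R) :
  (forall e : R, 0 < e -> exists2 d : R, 0 < d &
    forall (n : nat) (l r : 'I_n -> R), (forall i, l i <= r i) ->
      trivIset setT (fun i => `]l i, r i[%classic) ->
      \sum_(i < n) (r i - l i) < d -> \sum_(i < n) (G (r i) - G (l i)) < e) ->
  (lebesgue_stieltjes_measure G : set (measurableTypeR R) -> \bar R) `<< mu.
Proof.
move=> acG; apply/null_content_dominatesP => N mN muN0.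
set nu := (X in X N = _).
apply/eqP; rewrite eq_le measure_ge0 andbT; apply/lee_addgt0Pr => e e0.
rewrite add0e.
have [d d0 acGd] := acG _ e0.
have [|U [oU NU UNd]] := lebesgue_regularity_outer mN _ d0.
  by rewrite -[X in (X < _)%E]/(mu N) muN0.
have muU : (mu U < d%:E)%E.
  rewrite -(setDUK NU); apply: le_lt_trans UNd.
  rewrite (le_trans (measureU2 _ _ _))//.
  - by apply: measurableD => //; exact: open_measurable.
  - by rewrite muN0 add0e.
have UE := open_disjoint_itv_bigcup oU.
set I := open_disjoint_itv oU in UE.
have oI i : open (I i) by exact: open_disjoint_itv_open.
have mI i : measurable (I i) by exact: open_measurable.
have tI : trivIset setT I by exact: open_disjoint_itv_trivIset.
have IU i : I i `<=` U by rewrite UE; exact: bigcup_sup.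
have muI i : (mu (I i) < +oo)%E.
  apply: le_lt_trans (lt_trans muU (ltry _)).
  by apply: le_measure; rewrite ?inE//; exact: open_measurable.
have /choice[l /choice[r lr]] : forall i, exists l r, l <= r /\ I i = `]l, r[%classic.
  move=> i; apply: open_interval_finite_measure => //.
  exact: open_disjoint_itv_is_interval.
apply: (@le_trans _ _ (nu U)).
  by apply: le_measure; rewrite ?inE//; exact: open_measurable.
rewrite UE /nu (measure_bigcup (lebesgue_stieltjes_measure G))//=.
apply: lime_le; first exact: is_cvg_nneseries.
apply: nearW => n.
rewrite (eq_bigl xpredT); last by move=> i; rewrite in_setT.
apply: (@le_trans _ _ (\sum_(0 <= i < n) (G (r i) - G (l i))%:E)%E).
  apply: lee_sum => i _; have [lri ->] := lr i.
  rewrite -stieltjes_itv_oc//; apply: le_measure; rewrite ?inE//.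
  by apply: subset_itvl; rewrite bnd_simp.
rewrite sumEFin lee_fin ltW// big_mkord.
apply: (acGd n (fun i => l i) (fun i => r i)) => [i||].
- by have [] := lr i.
- apply/trivIsetP => i j _ _ ij.
  have [_ <-] := lr i; have [_ <-] := lr j.
  by move/trivIsetP : tI; apply.
- rewrite -lte_fin; apply: le_lt_trans muU.
  rewrite -sumEFin.
  rewrite (eq_bigr (fun i : 'I_n => mu (I i))); last first.
    move=> i _; have [+ ->] := lr i; rewrite lebesgue_measure_itv/= lte_fin.
    by rewrite le_eqVlt => /predU1P[->|->]; rewrite ?ltxx ?subrr// EFinB.
  rewrite -(measure_semi_additive_ord_I mu).
  + apply: le_measure; rewrite ?inE//.
    * by apply: bigsetU_measurable => k _; exact: mI.
    * exact: (open_measurable oU).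
    * by rewrite UE -bigcup_mkord => t [i _ ?]; exists i.
  + by move=> k _; exact: mI.
  + exact: sub_trivIset tI.
  + by apply: bigsetU_measurable => k _; exact: mI.
  + by move=> k _; exact: mI.
Qed.

(** Composition with the clamp [max a (min _ b)] extends a monotone function on
    the interval from [a] to [b] to the whole line without changing its modulus of absolute
    continuity. *)
Lemma clamp_itv a b x : a <= b -> a <= Num.max a (Num.min x b) <= b.
Proof. by move=> ab; rewrite le_max lexx/= ge_max ab ge_min lexx orbT. Qed.

Lemma clamp_id a b x : a <= x -> x <= b -> Num.max a (Num.min x b) = x.
Proof. by move=> ax xb; rewrite min_l// max_r. Qed.

Lemma le_clamp a b x y : x <= y ->
  Num.max a (Num.min x b) <= Num.max a (Num.min y b).
Proof. by move=> xy; rewrite le_max2// le_min2. Qed.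

Lemma clamp_lipschitz a b x y : x <= y ->
  Num.max a (Num.min y b) - Num.max a (Num.min x b) <= y - x.
Proof.
move=> xy; rewrite /Order.max /Order.min.
case: (ltP x b); case: (ltP y b) => *; case: ltP => *; case: ltP => *; lra.
Qed.

End density.

Section density_compact.
Set Implicit Arguments.
Unset Strict Implicit.
Context {R : realType}.
Implicit Types (F : R -> R) (a b x y : R).
Local Notation mu := (@lebesgue_measure R).

(** The Stieltjes measure of the clamped function has a Radon-Nikodym density,
    because it is dominated by the Lebesgue measure; Lebesgue differentiation of
    the indefinite integral identifies this density with the derivative. *)
Lemma AC_density_compact F a b : a <= b ->
  (forall x y, a <= x -> x <= y -> y <= b -> F x <= F y) ->
  absolutely_continuous a b F ->
  exists g : R -> R, [/\ measurable_fun [set: R] g, forall x, 0 <= g x,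
    forall x y, a <= x -> x <= y -> y <= b ->
      (\int[mu]_(t in `]x, y]%classic) (g t)%:E = (F y - F x)%:E)%E &
    {ae mu, forall t, a < t < b -> derivable F t 1 /\ derive1 F t = g t}].
Proof.
move=> ab ndF acF.
pose cl x := Num.max a (Num.min x b).
pose G0 x := F (cl x).
have cla x : a <= cl x by have /andP[] := clamp_itv x ab.
have clb x : cl x <= b by have /andP[] := clamp_itv x ab.
have ndG : {homo G0 : x y / x <= y}.
  by move=> x y xy; apply: ndF => //; exact: le_clamp.
have acG (e : R) : 0 < e -> exists2 d : R, 0 < d &
    forall (n : nat) (l r : 'I_n -> R), (forall i, l i <= r i) ->
      trivIset setT (fun i => `]l i, r i[%classic) ->
      \sum_(i < n) (r i - l i) < d -> \sum_(i < n) (G0 (r i) - G0 (l i)) < e.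
  move=> e0; have [d d0 dF] := acF e e0; exists d => // n l r lr tlr lrd.
  rewrite (eq_bigr (fun i => `|F (cl (r i)) - F (cl (l i))|)); last first.
    by move=> i _; rewrite ger0_norm// subr_ge0; exact: ndG.
  apply: dF.
  - by move=> i; split => //; exact: le_clamp.
  - have sub i : `]cl (l i), cl (r i)[ `<=` `]l i, r i[.
      move=> t /=; rewrite !in_itv/= /cl => /andP[].
      rewrite gt_max lt_max => /andP[a_t lt] /orP[ta|].
        by move: (lt_trans a_t ta); rewrite ltxx.
      rewrite lt_min => /andP[-> tb]; rewrite andbT.
      by move: lt; rewrite gt_min (ltNge b) (ltW tb) orbF.
    apply/trivIsetP => i j _ _ ij; apply/seteqP; split => // t [ti tj].
    by move/trivIsetP : tlr => /(_ i j I I ij) <-; split; exact: sub.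
  - by apply: le_lt_trans lrd; apply: ler_sum => i _; exact: clamp_lipschitz.
have rcG : right_continuous G0.
  move=> x; apply/cvgrPdist_lt => e e0; have [d d0 dG] := acG e e0.
  near=> y.
  have xy : x <= y by near: y; exact: nbhs_right_ge.
  rewrite distrC ger0_norm ?subr_ge0 ?ndG//.
  have := dG 1%N (fun=> x) (fun=> y); rewrite !big_ord1; apply => //.
    by apply/trivIsetP => i j _ _; rewrite !ord1 eqxx.
  by rewrite ltrBlDl; near: y; apply: nbhs_right_lt; rewrite ltrDl.
pose G : cumulative R R := HB.pack G0 (isCumulative.Build R _ R G0 ndG rcG).
have mI : measurable `]a, b]%classic by [].
have nufin : (lebesgue_stieltjes_measure G `]a, b]%classic < +oo)%E.
  by rewrite stieltjes_itv_oc// ltry.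
pose nu : {finite_measure set (measurableTypeR R) -> \bar R} :=
  mfrestr (mI : measurable (`]a, b]%classic : set (measurableTypeR R))) nufin.
have dom : nu `<< mu.
  have /null_content_dominatesP domG := @stieltjes_dominated R G acG.
  apply/null_content_dominatesP => N mN muN0; rewrite /nu/= /mfrestr /mrestr.
  apply/eqP; rewrite eq_le measure_ge0 andbT -(domG N mN muN0).
  by apply: le_measure; rewrite ?inE//; exact: measurableI.
have [f [f0 ffin fint fE]] := radon_nikodym_sigma_finite dom.
have fK t : (fine (f t))%:E = f t by rewrite fineK.
have intg : mu.-integrable setT (EFin \o (fine \o f)).
  by apply: eq_integrable fint => // t _ /=; rewrite fK.
have intG x y : a <= x -> x <= y -> y <= b ->
    (\int[mu]_(t in `]x, y]%classic) (fine (f t))%:E = (F y - F x)%:E)%E.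
  move=> ax xy yb; under eq_integral do rewrite fK.
  rewrite -fE// /nu/= /mfrestr /mrestr (_ : _ `&` _ = `]x, y]%classic); last first.
    rewrite setIidl//; apply: subset_itv; by rewrite bnd_simp.
  rewrite stieltjes_itv_oc//=.
  by rewrite /G0 /cl !clamp_id// ?(le_trans xy)// (le_trans ax).
exists (fine \o f); split => //.
- by have /integrableP[/measurable_EFinP] := intg.
- by move=> x; rewrite /= fine_ge0.
have := @FTC1Ny R (fine \o f).
have intgy (y : R) : mu.-integrable `]-oo, y] (EFin \o (fine \o f)).
  exact: integrableS intg.
move=> /(_ intgy (open_integrable_locally openT intg)).
apply: ae_lebesgueS => t /= [dt <-] /andP[a_t tb].
set Phi := fun x => _ in dt *.
have PhiE x : a <= x -> x <= b -> Phi x = F x - F a.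
  move=> ax xb; rewrite /Phi /Rintegral.
  under eq_integral do rewrite /= fK.
  rewrite -fE// /nu/= /mfrestr /mrestr (_ : _ `&` _ = `]a, x]%classic); last first.
    rewrite setIC; apply/seteqP; split => z /=; rewrite !in_itv/=.
      by move=> [/andP[-> _] ->].
    by move=> /andP[-> zx]; rewrite zx (le_trans zx xb).
  by rewrite stieltjes_itv_oc//= /G0 /cl !clamp_id.
have FE : \near t, F t = (Phi + cst (F a)) t.
  have : \forall s \near t, s \in `]a, b[%R by apply: near_in_itvoo; rewrite in_itv/= a_t tb.
  apply: filterS => s; rewrite in_itv/= => /andP[aS sb].
  by rewrite fctE PhiE ?ltW// subrK.
split; first by apply: near_eq_derivable (derivableD dt (derivable_cst (F a) t 1));
  near do apply/esym.
by rewrite !derive1E (near_eq_derive _ FE) deriveD// derive_cst addr0.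
Unshelve. all: by end_near. Qed.

End density_compact.

Section density_half_line.
Set Implicit Arguments.
Unset Strict Implicit.
Context {R : realType}.
Implicit Types (F : R -> R) (x y : R).
Local Notation mu := (@lebesgue_measure R).

Lemma near_exhaust x y : 0 < x ->
  \forall n \near \oo, n.+1%:R^-1 < x /\ y < n.+1%:R.
Proof.
move=> x0; near=> n; split.
  by near: n; exact: (near_infty_natSinv_lt (PosNum x0)).
apply: (@lt_trans _ _ n%:R); last by rewrite ltr_nat.
by near: n; exact: nbhs_infty_gtr.
Unshelve. all: by end_near. Qed.

(** The densities on the intervals from 1/(n+1) to n+1 all agree with the derivative
    almost everywhere; their upper limit is a Borel function that does so on the
    whole half-line. *)
Lemma AC_density F : nondecreasing_pos F -> AC_pos F ->
  exists g : R -> R, [/\ measurable_fun [set: R] g, forall x, 0 <= g x,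
    forall x y, 0 < x -> x <= y ->
      (\int[mu]_(t in `]x, y]%classic) (g t)%:E = (F y - F x)%:E)%E &
    {ae mu, forall t, 0 < t -> derivable F t 1 /\ derive1 F t = g t}].
Proof.
move=> ndF acF.
have lo n : 0 < n.+1%:R^-1 :> R by rewrite invr_gt0 ltr0n.
have lohi n : n.+1%:R^-1 <= n.+1%:R :> R.
  by rewrite (@le_trans _ _ 1)// ?invf_le1 ?ltr0n// ler1n.
have /choice[g_ g_P] : forall n, exists g : R -> R,
    [/\ measurable_fun [set: R] g, forall x, 0 <= g x,
    forall x y, n.+1%:R^-1 <= x -> x <= y -> y <= n.+1%:R ->
      (\int[mu]_(t in `]x, y]%classic) (g t)%:E = (F y - F x)%:E)%E &
    {ae mu, forall t, n.+1%:R^-1 < t < n.+1%:R -> derivable F t 1 /\ derive1 F t = g t}].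
  move=> n; apply: AC_density_compact => //; last exact: acF.
  by move=> x y nx xy _; apply: ndF => //; exact: lt_le_trans nx.
pose g t := `|fine (limn_esup (fun n => (g_ n t)%:E))|.
have mg : measurable_fun [set: R] g.
  apply: measurableT_comp => //; apply: measurableT_comp => //.
  apply: measurable_fun_limn_esup => n.
  by apply/measurable_EFinP; have [] := g_P n.
have dF : {ae mu, forall t, forall n, n.+1%:R^-1 < t < n.+1%:R ->
    derivable F t 1 /\ derive1 F t = g_ n t}.
  by apply/ae_foralln => n; have [] := g_P n.
have gE : {ae mu, forall t, 0 < t -> derivable F t 1 /\ derive1 F t = g t}.
  apply: ae_lebesgueS dF => t dFt t0.
  have cvgt : (fun n => (g_ n t)%:E) @ \oo --> (derive1 F t)%:E.
    apply: cvg_near_cst; near=> n; rewrite (dFt n _).2//.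
    by apply/andP; near: n; exact: near_exhaust.
  have /filter_ex[n /andP tn] := near_exhaust t t0.
  have [dt Ft] := dFt n tn; split => //.
  rewrite /g is_cvg_limn_esupE; last by apply/cvg_ex; exists (derive1 F t)%:E.
  rewrite (cvg_lim _ cvgt)//= ger0_norm//.
  by rewrite Ft; have [] := g_P n.
exists g; split => //; first by move=> x; exact: normr_ge0.
move=> x y x0 xy.
have [n [nx yn]] : exists n, n.+1%:R^-1 < x /\ y < n.+1%:R.
  by have /filter_ex[n] := near_exhaust y x0; exists n.
have [mgn gn0 gnE dFn] := g_P n.
rewrite -(gnE x y (ltW nx) xy (ltW yn)).
apply: ge0_ae_eq_integral => //.
- by apply/measurable_EFinP; exact: measurable_funTS.
- by apply/measurable_EFinP; exact: measurable_funTS.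
- by move=> t _; rewrite lee_fin normr_ge0.
- by move=> t _; rewrite lee_fin.
apply: ae_lebesgueS2 gE dFn => t gt dFnt /=.
rewrite in_itv/= => /andP[xt ty].
have tn : n.+1%:R^-1 < t < n.+1%:R by rewrite (lt_trans nx xt) (le_lt_trans ty yn).
by have [_ <-] := gt (lt_trans x0 xt); have [_ ->] := dFnt tn.
Unshelve. all: by end_near. Qed.

End density_half_line.

(** * Seminorms and the K-functional *)

Section infimum.
Set Implicit Arguments.
Unset Strict Implicit.
Context {R : realType}.
Implicit Types (S T : set \bar R) (m : \bar R).
Local Open Scope ereal_scope.

Lemma lee_ereal_infD S T m :
  (forall x, S x -> 0 <= x < +oo) -> (forall y, T y -> 0 <= y < +oo) ->
  (forall x y, S x -> T y -> m <= x + y) -> m <= ereal_inf S + ereal_inf T.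
Proof.
move=> S0 T0 mST.
have fin (U : set (\bar R)) (x : \bar R) :
    (forall x, U x -> 0 <= x < +oo) -> U x -> x \is a fin_num.
  by move=> U0 /U0/andP[x0 xoo]; rewrite ge0_fin_numE.
have inf0 (U : set (\bar R)) : (forall x, U x -> 0 <= x < +oo) -> 0 <= ereal_inf U.
  by move=> U0; apply/ereal_infP => x /U0/andP[].
have [infS|infS] := eqVneq (ereal_inf S) +oo.
  by rewrite infS addye ?leey// -ltNye (lt_le_trans _ (inf0 _ T0)).
have finS : ereal_inf S \is a fin_num by rewrite ge0_fin_numE ?inf0// ltey.
rewrite -leeBlDl//; apply/ereal_infP => y Ty.
rewrite leeBlDl// addeC -leeBlDl ?(fin _ _ T0)//; apply/ereal_infP => x Sx.
by rewrite leeBlDl ?(fin _ _ T0)// addeC; exact: mST.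
Qed.

Lemma lee_ereal_infZ S m (r : R) : (0 <= r)%R -> S !=set0 ->
  (forall x, S x -> m <= r%:E * x) -> m <= r%:E * ereal_inf S.
Proof.
rewrite le_eqVlt => /predU1P[<- [x Sx] mS|r0 _ mS].
  by rewrite mul0e; have := mS _ Sx; rewrite mul0e.
by rewrite -ereal_inf_pZl//; apply/ereal_infP => _ [x Sx <-]; exact: mS.
Qed.

End infimum.

Section seminormed.
Set Implicit Arguments.
Unset Strict Implicit.
Context {R : realType} {Z : topologicalLmodType R}.
Implicit Types (E X Y : @nspace R Z) (f g : Z) (t : R).
Local Open Scope ereal_scope.

(** An [nspace] is bare data. These properties are shared by the embedded spaces,
    their intersection and their sum, and also by the sum equipped with the
    functional [K(., t)], to which they are applied below for each [t]. *)
Record seminormed E : Prop := Seminormed {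
  elts0 : elts E 0%R ;
  eltsD : forall f g, elts E f -> elts E g -> elts E (f + g)%R ;
  eltsZ : forall (a : R) f, elts E f -> elts E (a *: f) ;
  nrm_ge0 : forall f, 0 <= nrm E f ;
  nrm_lty : forall f, elts E f -> nrm E f < +oo ;
  nrmD : forall f g, elts E f -> elts E g -> nrm E (f + g)%R <= nrm E f + nrm E g ;
  nrmZ : forall (a : R) f, elts E f -> nrm E (a *: f) <= `|a|%:E * nrm E f }.

Section theory.
Variables (E : @nspace R Z) (nE : seminormed E).

Lemma nrm0 : nrm E 0%R = 0.
Proof.
apply/eqP; rewrite eq_le nrm_ge0// andbT.
by have := nrmZ nE 0%R (elts0 nE); rewrite scale0r normr0 mul0e.
Qed.

Lemma eltsN f : elts E f -> elts E (- f)%R.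
Proof. by move=> Ef; rewrite -scaleN1r; exact: eltsZ. Qed.

Lemma eltsB f g : elts E f -> elts E g -> elts E (f - g)%R.
Proof. by move=> Ef Eg; apply: eltsD => //; exact: eltsN. Qed.

Lemma nrmN f : elts E f -> nrm E (- f)%R = nrm E f.
Proof.
have h g : elts E g -> nrm E (- g)%R <= nrm E g.
  by move=> Eg; rewrite -scaleN1r (le_trans (nrmZ _ _ _))// normrN1 mul1e.
move=> Ef; apply/eqP; rewrite eq_le h//=.
by rewrite -{1}(opprK f) h//; exact: eltsN.
Qed.

Lemma nrmB f g : elts E f -> elts E g -> nrm E (f - g)%R <= nrm E f + nrm E g.
Proof. by move=> Ef Eg; rewrite -(nrmN Eg) nrmD//; exact: eltsN. Qed.

Lemma elts_sum (I : Type) (r : seq I) (P : pred I) (F : I -> Z) :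
  (forall i, P i -> elts E (F i)) -> elts E (\sum_(i <- r | P i) F i)%R.
Proof.
move=> EF; elim/big_rec : _ => [|i x Pi Ex]; first exact: elts0.
by apply: eltsD => //; exact: EF.
Qed.

Lemma nrm_sum (I : Type) (r : seq I) (P : pred I) (F : I -> Z) :
  (forall i, P i -> elts E (F i)) ->
  nrm E (\sum_(i <- r | P i) F i)%R <= \sum_(i <- r | P i) nrm E (F i).
Proof.
move=> EF.
suff [] : elts E (\sum_(i <- r | P i) F i)%R /\
    nrm E (\sum_(i <- r | P i) F i)%R <= \sum_(i <- r | P i) nrm E (F i) by [].
elim/big_rec2 : _ => [|i x y Pi [Ey yx]]; first by rewrite nrm0; split => //; exact: elts0.
split; first by apply: eltsD => //; exact: EF.
by rewrite (le_trans (nrmD _ _ _))// ?leeD2l//; exact: EF.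
Qed.

End theory.

Lemma embedded_seminormed (V : normedModType R) (i : {linear V -> Z}) :
  seminormed (embedded i).
Proof.
have rangeP f : range i f -> [set `|x|%:E | x in i @^-1` [set f]] !=set0.
  by move=> [x _ <-]; exists `|x|%:E; exists x.
have nge0 f x : [set `|x|%:E | x in i @^-1` [set f]] x -> 0 <= x < +oo.
  by move=> [v _ <-]; rewrite lee_fin normr_ge0 ltry.
split => /=.
- by exists 0%R => //; rewrite linear0.
- by move=> _ _ [x _ <-] [y _ <-]; exists (x + y)%R => //; rewrite linearD.
- by move=> a _ [x _ <-]; exists (a *: x) => //; rewrite linearZ.
- by move=> f; apply/ereal_infP => x /nge0/andP[].
- move=> f [x _ xf]; apply: (@le_lt_trans _ _ `|x|%:E); last exact: ltry.
  by apply: ge_ereal_inf; exists `|x|%:E => //; exists x.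
- move=> f g _ _; apply: lee_ereal_infD => [x /nge0//|y /nge0//|].
  move=> _ _ [x xf <-] [y yg <-].
  apply: ge_ereal_inf; exists `|x + y|%:E; last by rewrite -EFinD lee_fin ler_normD.
  by exists (x + y)%R => //=; rewrite linearD xf yg.
- move=> a f /rangeP fr; apply: lee_ereal_infZ => // _ [x xf <-].
  apply: ge_ereal_inf; exists `|a *: x|%:E; last by rewrite normrZ EFinM.
  by exists (a *: x) => //=; rewrite linearZ xf.
Qed.

Section couple.
Variables (X Y : @nspace R Z) (nX : seminormed X) (nY : seminormed Y).

Let Kset f t := [set nrm X p.1 + t%:E * nrm Y p.2 | p in decomp X Y f].

Let Kset_ge0 f t : (0 <= t)%R -> forall x, Kset f t x -> 0 <= x < +oo.
Proof.
move=> t0 _ [[p q] [/= Xp Yq _] <-]; rewrite adde_ge0 ?nrm_ge0//=; last first.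
  by rewrite mule_ge0 ?nrm_ge0.
by rewrite lte_add_pinfty ?nrm_lty// lte_mul_pinfty ?nrm_lty.
Qed.

Lemma Kfun_le f p q t : elts X p -> elts Y q -> f = (p + q)%R ->
  Kfun X Y f t <= nrm X p + t%:E * nrm Y q.
Proof.
move=> Xp Yq ->; apply: ge_ereal_inf; exists (nrm X p + t%:E * nrm Y q) => //.
by exists (p, q).
Qed.

Lemma Kfun_le_l f t : elts X f -> Kfun X Y f t <= nrm X f.
Proof.
move=> Xf; rewrite (le_trans (Kfun_le t Xf (elts0 nY) (esym (addr0 f))))//.
by rewrite nrm0// mule0 adde0.
Qed.

Lemma Kfun_le_r f t : elts Y f -> Kfun X Y f t <= t%:E * nrm Y f.
Proof.
move=> Yf; rewrite (le_trans (Kfun_le t (elts0 nX) Yf (esym (add0r f))))//.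
by rewrite nrm0// add0e.
Qed.

Lemma sum_nrmE f : nrm (sum_space X Y) f = Kfun X Y f 1.
Proof. by congr ereal_inf; apply: eq_imagel => p _; rewrite mul1e. Qed.

Lemma elts_suml f : elts X f -> elts (sum_space X Y) f.
Proof. by move=> Xf; exists (f, 0%R); split => //=; rewrite ?addr0//; exact: elts0. Qed.

Lemma elts_sumr f : elts Y f -> elts (sum_space X Y) f.
Proof. by move=> Yf; exists (0%R, f); split => //=; rewrite ?add0r//; exact: elts0. Qed.

Lemma Kfun_seminormed t : (0 <= t)%R ->
  seminormed (NSpace (elts (sum_space X Y)) (fun f => Kfun X Y f t)).
Proof.
move=> t0; split => /=.
- by apply: elts_suml; exact: elts0.
- move=> _ _ [[p q] [/= Xp Yq ->]] [[p' q'] [/= Xp' Yq' ->]].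
  by exists (p + p', q + q')%R; split => /=; [exact: eltsD..|rewrite addrACA].
- move=> a _ [[p q] [/= Xp Yq ->]].
  by exists (a *: p, a *: q)%R; split => /=; [exact: eltsZ..|rewrite scalerDr].
- by move=> f; apply/ereal_infP => x /(Kset_ge0 t0)/andP[].
- move=> f [[p q] [/= Xp Yq fE]]; rewrite (le_lt_trans (Kfun_le t Xp Yq fE))//.
  by rewrite lte_add_pinfty ?nrm_lty// lte_mul_pinfty ?nrm_lty.
- move=> f g _ _; apply: lee_ereal_infD; [exact: Kset_ge0..|].
  move=> _ _ [[p q] [/= Xp Yq ->] <-] [[p' q'] [/= Xp' Yq' ->] <-].
  have fgE : (p + q + (p' + q') = (p + p') + (q + q'))%R by rewrite addrACA.
  rewrite (le_trans (Kfun_le t (eltsD nX Xp Xp') (eltsD nY Yq Yq') fgE))//.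
  rewrite addeACA leeD//; first exact: nrmD.
  rewrite -ge0_muleDr ?nrm_ge0// lee_wpmul2l//; exact: nrmD.
- move=> a f [pq fpq]; apply: lee_ereal_infZ => //.
    by exists (nrm X pq.1 + t%:E * nrm Y pq.2); exists pq.
  move=> _ [[p q] [/= Xp Yq ->] <-].
  rewrite (le_trans (Kfun_le t (eltsZ nX a Xp) (eltsZ nY a Yq) (scalerDr _ _ _)))//.
  rewrite ge0_muleDr ?nrm_ge0 ?mule_ge0 ?nrm_ge0// leeD//; first exact: nrmZ.
  by rewrite muleCA lee_wpmul2l//; exact: nrmZ.
Qed.

Lemma sum_seminormed : seminormed (sum_space X Y).
Proof.
have [e0 eD eZ n0 ny nD nZ] := Kfun_seminormed (@ler01 R).
split => [//|//|//|f|f Ef|f g Ef Eg|a f Ef]; rewrite !sum_nrmE.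
- exact: n0.
- exact: ny.
- exact: nD.
- exact: nZ.
Qed.

Lemma le_Kfun f s t : (s <= t)%R -> Kfun X Y f s <= Kfun X Y f t.
Proof.
move=> st; apply/ereal_infP => _ [[p q] [/= Xp Yq ->] <-].
rewrite (le_trans (Kfun_le s Xp Yq erefl))// leeD2l// lee_wpmul2r ?nrm_ge0//.
Qed.

Lemma Kfun_le_nrm f t : elts (sum_space X Y) f ->
  Kfun X Y f t <= (Num.max 1 t)%:E * nrm (sum_space X Y) f.
Proof.
move=> [pq fpq]; rewrite sum_nrmE; apply: lee_ereal_infZ.
- by rewrite le_max ler01.
- by exists (nrm X pq.1 + 1%:E * nrm Y pq.2); exists pq.
move=> _ [[p q] [/= Xp Yq ->] <-]; rewrite mul1e.
rewrite (le_trans (Kfun_le t Xp Yq erefl))// ge0_muleDr ?nrm_ge0// leeD//.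
  by rewrite -[leLHS]mul1e lee_wpmul2r ?nrm_ge0// lee_fin le_max lexx.
by rewrite lee_wpmul2r ?nrm_ge0// lee_fin le_max lexx orbT.
Qed.

Lemma cap_seminormed : seminormed (cap_space X Y).
Proof.
split => /=.
- by split; exact: elts0.
- by move=> f g [Xf Yf] [Xg Yg]; split; exact: eltsD.
- by move=> a f [Xf Yf]; split; exact: eltsZ.
- by move=> f; rewrite le_max nrm_ge0.
- by move=> f [Xf Yf]; rewrite gt_max !nrm_lty.
- move=> f g [Xf Yf] [Xg Yg]; rewrite ge_max; apply/andP; split.
    by rewrite (le_trans (nrmD _ _ _))// leeD// le_max lexx.
  by rewrite (le_trans (nrmD _ _ _))// leeD// le_max lexx orbT.
- move=> a f [Xf Yf]; rewrite ge_max; apply/andP; split.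
    by rewrite (le_trans (nrmZ _ _ _))// lee_wpmul2l// le_max lexx.
  by rewrite (le_trans (nrmZ _ _ _))// lee_wpmul2l// le_max lexx orbT.
Qed.

Lemma Jfun_ge0 f t : 0 <= Jfun X Y f t.
Proof. by rewrite le_max (nrm_ge0 nX). Qed.

End couple.
End seminormed.

(** * Seminorms of Bochner integrals *)

Section lower_integral.
Set Implicit Arguments.
Unset Strict Implicit.
Local Open Scope ereal_scope.
Context d (T : measurableType d) (R : realType).
Variables (mu : {measure set T -> \bar R}) (D : set T).

(** The integral of a nonnegative function is a supremum over the simple functions
    below it, so it is monotone even on functions that are not measurable, such
    as the norm of a difference in the definition of the Bochner integral. *)
Lemma ge0_le_lower_integral (A : set T) (f g : T -> \bar R) : A `<=` D ->
  (forall x, A x -> 0 <= f x) -> (forall x, D x -> 0 <= g x) ->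
  (forall x, A x -> f x <= g x) ->
  \int[mu]_(x in A) f x <= \int[mu]_(x in D) g x.
Proof.
move=> AD f0 g0 fg; rewrite !ge0_integralE//.
apply: ge_ereal_sup => _ [h /= hf <-]; apply: ereal_sup_ubound; exists h => //= x.
apply: le_trans (hf x) _; rewrite !patchE.
case: ifPn => xA; case: ifPn => xD //.
- by apply: fg; exact: set_mem.
- by move: xA xD; rewrite inE => /AD/mem_set ->.
- by rewrite g0//; exact: set_mem.
Qed.

Lemma ae_ge0_le_lower_integral (f g : T -> \bar R) : measurable D ->
  measurable_fun D f -> (forall x, D x -> 0 <= f x) ->
  (forall x, D x -> 0 <= g x) -> {ae mu, forall x, D x -> f x <= g x} ->
  \int[mu]_(x in D) f x <= \int[mu]_(x in D) g x.
Proof.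
move=> mD mf f0 g0 [N [mN muN fgN]]; rewrite (ge0_negligible_integral mN)//.
apply: ge0_le_lower_integral => // x [Dx Nx]; first exact: f0.
by apply: contrapT => nfg; apply: Nx; apply: fgN => /= /(_ Dx).
Qed.

End lower_integral.

Section bochner_seminorm.
Set Implicit Arguments.
Unset Strict Implicit.
Local Open Scope ereal_scope.
Context {R : realType} {Z : topologicalLmodType R}.
Implicit Types (E p : @nspace R Z) (D : set R) (s u : R -> Z) (z f : Z).
Local Notation mu := (@lebesgue_measure R).

(** Functions of the form [phi \o sigma] with [sigma] of finite range; a simple
    function is the case where [sigma] is the function itself. *)
Section finite_range.
Variables (T : choiceType) (D : set R) (sigma : R -> T) (phi : T -> \bar R).
Hypotheses (mD : measurable D) (fin_sigma : finite_set (sigma @` D))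
  (msigma : forall j, measurable (D `&` sigma @^-1` [set j])).

Let finite_range_sum t : D t -> phi (sigma t) =
  \sum_(j \in sigma @` D) (phi j * (\1_(D `&` sigma @^-1` [set j]) t)%:E).
Proof.
move=> Dt; rewrite (fsbigD1 (sigma t))//.
rewrite indicE mem_set//= mule1 fsbig1 ?adde0// => j [_ /= jst].
by rewrite indicE memNset ?mule0// => -[_ /= sj]; apply: jst.
Qed.

Lemma measurable_finite_range : measurable_fun D (phi \o sigma).
Proof.
apply: (@eq_measurable_fun _ _ _ _ _ (fun t => \sum_(j \in sigma @` D)
    (phi j * (\1_(D `&` sigma @^-1` [set j]) t)%:E))).
  by move=> t; rewrite inE => /finite_range_sum.
apply: emeasurable_fsum => // j.
by apply: measurable_funeM; apply/measurable_EFinP; apply: measurable_indic; exact: msigma.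
Qed.

Lemma integral_finite_range : (forall j, 0 <= phi j) ->
  \int[mu]_(t in D) phi (sigma t) =
  \sum_(j \in sigma @` D) (phi j * mu (D `&` sigma @^-1` [set j])).
Proof.
move=> phi0.
have -> : \int[mu]_(t in D) phi (sigma t) = \int[mu]_(t in D)
    (\sum_(j \in sigma @` D) (phi j * (\1_(D `&` sigma @^-1` [set j]) t)%:E)).
  by apply: eq_integral => t; rewrite inE => /finite_range_sum.
have mindic j : measurable_fun D
    (fun t => (\1_(D `&` sigma @^-1` [set j]) t)%:E : \bar R).
  by apply/measurable_EFinP; apply: measurable_indic; exact: msigma.
rewrite ge0_integral_fsum//; last 2 first.
- by move=> j; apply: measurable_funeM; exact: mindic.
- by move=> j t _; rewrite mule_ge0// lee_fin.
apply: eq_fsbigr => j _; rewrite ge0_integralZl//; last exact: mindic.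
rewrite integral_indic//; last exact: msigma.
by rewrite setIAC setIid.
Qed.

End finite_range.

Lemma simple_integral_elts E D s : seminormed E -> simple_fun E D s ->
  elts E (simple_integral D s).
Proof.
move=> nE [sE fins _]; rewrite /simple_integral fsbig_finite//= big_seq.
apply: elts_sum => // z; rewrite in_fset_set// inE => -[t Dt <-].
by apply: eltsZ => //; exact: sE.
Qed.

Lemma nrm_simple_integral_le E p D s : seminormed p -> measurable D ->
  (forall f, elts E f -> elts p f) ->
  simple_fun E D s -> simple_integrable D s ->
  nrm p (simple_integral D s) <= \int[mu]_(t in D) nrm p (s t).
Proof.
move=> np mD Ep sE si; have [sDE fins ms] := sE.
rewrite (integral_finite_range mD fins ms (nrm_ge0 np)).
rewrite /simple_integral !fsbig_finite//= big_seq.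
rewrite (le_trans (nrm_sum np _ _))//.
  move=> z; rewrite in_fset_set// inE => -[t Dt <-].
  by apply: eltsZ => //; apply: Ep; exact: sDE.
rewrite [leRHS]big_seq; apply: lee_sum => z; rewrite in_fset_set// inE => -[t Dt stz].
have Epz : elts p z by rewrite -stz; apply: Ep; exact: sDE.
rewrite (le_trans (nrmZ np _ Epz))//.
have [->|z0] := eqVneq z 0%R; first by rewrite nrm0// mul0e mule0.
rewrite muleC lee_wpmul2l ?nrm_ge0//.
rewrite ger0_norm ?fine_ge0// fineK// ge0_fin_numE//; exact: si.
Qed.

(** Minkowski's inequality. If [s] is a simple approximation of [u], then
    [p (s t) <= G t + (p (s t) - G t)^+]; the positive part is measurable and at
    most [C * nrm E (u t - s t)], whose integral tends to 0. *)
Lemma nrm_bochner_le E p (C : R) D u f (G : R -> \bar R) :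
  seminormed E -> seminormed p -> (0 < C)%R ->
  (forall z, elts E z -> elts p z) ->
  (forall z, elts E z -> nrm p z <= C%:E * nrm E z) ->
  measurable D -> has_bochner_integral E D u f ->
  measurable_fun D G -> (forall t, D t -> 0 <= G t) ->
  {ae mu, forall t, D t -> nrm p (u t) <= G t} ->
  nrm p f <= \int[mu]_(t in D) G t.
Proof.
move=> nE np C0 Ep pC mD [[uE _] Ef [s [s_ sI sf]]] mG G0 uG.
have [->|Goo] := eqVneq (\int[mu]_(t in D) G t) +oo; first exact: leey.
have Gfin : \int[mu]_(t in D) G t \is a fin_num.
  by rewrite ge0_fin_numE ?integral_ge0// ltey.
pose I n := \int[mu]_(t in D) nrm E (u t - s n t)%R.
pose e n := nrm E (simple_integral D (s n) - f)%R.
have key n : nrm p f <= \int[mu]_(t in D) G t + (C%:E * I n + C%:E * e n).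
  have [sE si] := s_ n; have [sDE _ _] := sE.
  have SE := simple_integral_elts nE sE.
  have -> : f = (simple_integral D (s n) - (simple_integral D (s n) - f))%R.
    by rewrite subKr.
  have SfE : elts E (simple_integral D (s n) - f)%R by exact: eltsB.
  rewrite (le_trans (nrmB np (Ep _ SE) (Ep _ SfE)))// addeA.
  apply: leeD; last exact: pC.
  rewrite (le_trans (nrm_simple_integral_le np mD Ep sE si))//.
  pose q t := nrm p (s n t).
  have mq : measurable_fun D q
    by have [_ fins ms] := sE; exact: (measurable_finite_range (nrm p) fins ms).
  pose h t := maxe (q t - G t) 0.
  have mh : measurable_fun D h.
    by apply: measurable_maxe => //; exact: emeasurable_funB.
  have h0 t : 0 <= h t by rewrite le_max lexx orbT.
  apply: (@le_trans _ _ (\int[mu]_(t in D) (G t + h t))).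
    apply: ge0_le_integral => //.
    - by move=> t _; exact: nrm_ge0.
    - exact: emeasurable_funD.
    move=> t Dt; rewrite -/(q t).
    have [->|Gtoo] := eqVneq (G t) +oo.
      by rewrite addye ?leey// -ltNye (lt_le_trans _ (h0 t)).
    have Gtf : G t \is a fin_num by rewrite ge0_fin_numE ?G0// ltey.
    by rewrite -leeBlDl// le_max lexx.
  rewrite ge0_integralD// leeD2l//.
  rewrite -lee_pdivrMl// -ge0_integralZl//; last by rewrite lee_fin invr_ge0 ltW.
  apply: ae_ge0_le_lower_integral => //.
  - exact: measurable_funeM.
  - by move=> t _; rewrite mule_ge0// lee_fin invr_ge0 ltW.
  - by move=> t _; exact: nrm_ge0.
  apply: ae_lebesgueS uG => t uGt Dt.
  have Et : elts E (u t - s n t)%R by apply: eltsB => //; [exact: uE|exact: sDE].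
  rewrite lee_pdivrMl// ge_max mule_ge0 ?nrm_ge0//; last by rewrite lee_fin ltW.
  rewrite andbT.
  have [->|Gtoo] := eqVneq (G t) +oo; first by rewrite addeNy leNye.
  have Gtf : G t \is a fin_num by rewrite ge0_fin_numE ?G0// ltey.
  rewrite leeBlDl// /q.
  rewrite -{1}(subKr (u t) (s n t)).
  rewrite (le_trans (nrmB np (Ep _ (uE _ Dt)) (Ep _ Et)))//.
  by apply: leeD; [exact: uGt|exact: pC].
have cvg : (fun n => \int[mu]_(t in D) G t + (C%:E * I n + C%:E * e n)) @ \oo
    --> \int[mu]_(t in D) G t.
  rewrite -[X in _ --> X]adde0; apply: cvgeD => //; [exact: fin_num_adde_defr|exact: cvg_cst|].
  rewrite -[X in _ --> X](adde0 0); apply: cvgeD => //.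
  - by rewrite -(mule0 C%:E); apply: cvgeZl.
  - by rewrite -(mule0 C%:E); apply: cvgeZl.
rewrite -(cvg_lim _ cvg)//; apply: lime_ge; last exact: nearW.
by apply/cvg_ex; exists (\int[mu]_(t in D) G t).
Qed.

End bochner_seminorm.

(** * Bochner integrals of layered functions *)

Section simple_comp.
Set Implicit Arguments.
Unset Strict Implicit.
Context {R : realType} {Z : topologicalLmodType R}.
Local Notation mu := (@lebesgue_measure R).
Variables (T : choiceType) (D : set R) (sigma : R -> T).
Hypotheses (fin_sigma : finite_set (sigma @` D))
  (msigma : forall j, measurable (D `&` sigma @^-1` [set j])).
Implicit Types (phi : T -> Z) (z : Z).

Let J : seq T := finmap.enum_fset (fset_set (sigma @` D)).

Let mem_J t : D t -> sigma t \in J.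
Proof. by move=> Dt; rewrite in_fset_set// inE; exists t. Qed.

Let level_comp phi z : D `&` (phi \o sigma) @^-1` [set z] =
  \bigcup_(j in [set` [seq j <- J | phi j == z]]) (D `&` sigma @^-1` [set j]).
Proof.
apply/seteqP; split => t /=.
  move=> [Dt <-]; exists (sigma t) => //=.
  by rewrite mem_filter eqxx mem_J.
by move=> [j /=]; rewrite mem_filter => /andP[/eqP <- _] [Dt <-].
Qed.

Let measure_level_comp phi z : mu (D `&` (phi \o sigma) @^-1` [set z]) =
  (\sum_(j <- J | phi j == z) mu (D `&` sigma @^-1` [set j]))%E.
Proof.
rewrite level_comp measure_fin_bigcup//.
- by rewrite -fsbig_seq ?filter_uniq ?finmap.fset_uniq// big_filter.
- apply/trivIsetP => i j _ _ ij; apply/seteqP; split => // t [[_ /= si] [_ /= sj]].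
  by move: ij; rewrite -si -sj eqxx.
- by move=> j _; exact: msigma.
Qed.

Lemma simple_fun_comp (E : nspace) phi :
  (forall j, elts E (phi j)) -> simple_fun E D (phi \o sigma).
Proof.
move=> Ephi; split => [t _||z]; first exact: Ephi.
  by rewrite -image_comp; exact: finite_image.
rewrite level_comp; apply: fin_bigcup_measurable => // j _; exact: msigma.
Qed.

Lemma simple_integrable_comp phi :
  (forall j, phi j != 0 -> (mu (D `&` sigma @^-1` [set j]) < +oo)%E) ->
  simple_integrable D (phi \o sigma).
Proof.
move=> sfin z z0; rewrite measure_level_comp.
by apply: lte_sum_pinfty => j /eqP phij; apply: sfin; rewrite phij.
Qed.

(** The integral of a simple function may be computed on any finer partition: the
    levels of [sigma] mapped to the same vector add up. *)
Lemma simple_integral_comp phi :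
  (forall j, phi j != 0 -> (mu (D `&` sigma @^-1` [set j]) < +oo)%E) ->
  simple_integral D (phi \o sigma) =
  \sum_(j <- J) fine (mu (D `&` sigma @^-1` [set j])) *: phi j.
Proof.
move=> sfin.
have finphi : finite_set ((phi \o sigma) @` D).
  by rewrite -image_comp; exact: finite_image.
rewrite /simple_integral fsbig_finite//=.
set V : seq Z := finmap.enum_fset (fset_set _).
have phiV j : j \in J -> phi j \in V.
  rewrite /J in_fset_set// inE => -[t Dt <-].
  by rewrite in_fset_set// inE; exists t.
transitivity (\sum_(z <- V) \sum_(j <- J)
    if phi j == z then fine (mu (D `&` sigma @^-1` [set j])) *: z else 0).
  apply: eq_bigr => z _.
  rewrite -big_mkcond -scaler_suml.
  have [->|z0] := eqVneq z 0; first by rewrite !scaler0.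
  congr (_ *: _); rewrite measure_level_comp sum_fine// => j /eqP phij.
  by rewrite ge0_fin_numE//; apply: sfin; rewrite phij.
rewrite exchange_big; apply: eq_big_seq => j Jj.
rewrite (bigD1_seq (phi j)) ?phiV ?finmap.fset_uniq//= eqxx big1 ?addr0// => z zj.
by rewrite eq_sym (negbTE zj).
Qed.

(** Both sides are computed on the partition by the levels of [sigma]; the right one
    involves scalar Lebesgue integrals, to which limit theorems apply. *)
Lemma simple_integral_lincomb n (a : nat -> T -> R) (v : nat -> Z) : measurable D ->
  (forall k j, 0 <= a k j) ->
  (forall k j, (k < n)%N -> a k j != 0 -> (mu (D `&` sigma @^-1` [set j]) < +oo)%E) ->
  simple_integral D (fun t => \sum_(k < n) a k (sigma t) *: v k) =
  \sum_(k < n) fine (\int[mu]_(t in D) (a k (sigma t))%:E)%E *: v k.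
Proof.
move=> mD a0 sfin.
pose phi j := \sum_(k < n) a k j *: v k.
rewrite -[LHS]/(simple_integral D (phi \o sigma)) simple_integral_comp; last first.
  move=> j; apply: contraPP => /negP; rewrite -leNgt leye_eq => /eqP muoo.
  suff -> : phi j = 0 by rewrite eqxx.
  apply: big1 => k _; have [->|ak0] := eqVneq (a k j) 0; first by rewrite scale0r.
  by have := sfin k j (ltn_ord k) ak0; rewrite muoo ltxx.
under eq_bigr do rewrite scaler_sumr.
rewrite exchange_big; apply: eq_bigr => k _.
rewrite (integral_finite_range mD fin_sigma msigma
  (phi := fun j => (a k j)%:E)) => [|j]; last first.
  by rewrite lee_fin.
rewrite fsbig_finite//= -sum_fine => [|j _]; last first.
  have [->|ak0] := eqVneq (a k j) 0; first by rewrite mul0e.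
  by rewrite fin_numM// ge0_fin_numE//; exact: (sfin k).
rewrite scaler_suml; apply: eq_bigr => j _; rewrite scalerA.
suff -> : fine ((a k j)%:E * mu (D `&` sigma @^-1` [set j]))%E =
    fine (mu (D `&` sigma @^-1` [set j])) * a k j by [].
have [->|ak0] := eqVneq (a k j) 0; first by rewrite mulr0 mul0e.
rewrite fineM//= 1?mulrC// ge0_fin_numE//; exact: (sfin k).
Qed.

End simple_comp.

(** A layered function is [h t *: v (kappa t)]: the vector is constant on each
    layer [kappa t = k], and [h] is a scalar density. It is approximated by
    keeping the first [n] layers and replacing [h] there by a simple function. *)
Section layered.
Import HBNNSimple.
Set Implicit Arguments.
Unset Strict Implicit.
Context {R : realType} {Z : topologicalLmodType R}.
Local Notation mu := (@lebesgue_measure R).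
Variables (E : @nspace R Z) (D : set R) (h : R -> R) (kappa : R -> nat)
  (v : nat -> Z).
Hypotheses (nE : seminormed E) (mD : measurable D)
  (mh : measurable_fun [set: R] h) (h_ge0 : forall t, 0 <= h t)
  (mkappa : forall k, measurable (D `&` kappa @^-1` [set k]))
  (Ev : forall k, elts E (v k)).

Let mhE : measurable_fun [set: R] (EFin \o h).
Proof. exact/measurable_EFinP. Qed.

Let hn n : R -> R := nnsfun_approx measurableT mhE n.

Let hn_ge0 n t : 0 <= hn n t. Proof. by rewrite /hn. Qed.

Let hn_le n t : hn n t <= h t.
Proof.
rewrite -lee_fin /hn nnsfun_approxE.
by apply: (@le_approx _ _ _ setT (EFin \o h)) => // x _; rewrite lee_fin.
Qed.

Let hn_cvg t : hn n t @[n --> \oo] --> h t.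
Proof.
have /fine_cvgP[_] := @cvg_nnsfun_approx _ _ _ setT measurableT (EFin \o h) mhE
  (fun x _ => h_ge0 x) t I; exact.
Qed.

Let mhn n : measurable_fun [set: R] (hn n).
Proof. by rewrite /hn. Qed.

(* The index is capped at [n], which stands for all the discarded layers, so that
   [sigma n] has finite range. *)
Let sigma n t : nat * R := (minn (kappa t) n, hn n t).

Let coef (k : nat) (j : nat * R) : R := if j.1 == k then `|j.2| else 0.

Let coef_ge0 k j : 0 <= coef k j.
Proof. by rewrite /coef; case: ifP. Qed.

Let approx n t := \sum_(k < n) coef k (sigma n t) *: v k.

Let trunc n t : R := if (kappa t < n)%N then hn n t else 0.

Let approxE n t : approx n t = trunc n t *: v (kappa t).
Proof.
rewrite /approx /trunc; case: ltnP => kn.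
  rewrite (bigD1 (Ordinal kn))//= /coef/= (minn_idPl (ltnW kn)) eqxx big1 ?addr0.
    by rewrite ger0_norm.
  by move=> i; rewrite eq_sym -val_eqE/= => /negbTE ->; rewrite scale0r.
rewrite big1 ?scale0r// => i _; rewrite /coef/= (minn_idPr kn).
by rewrite gtn_eqF ?scale0r.
Qed.

Let finite_sigma n : finite_set (sigma n @` D).
Proof.
apply: (@sub_finite_set _ _ (`I_n.+1 `*` range (hn n))).
  by move=> _ [t Dt <-]; split => /=; [rewrite ltnS geq_minr|exists t].
by apply: finite_setX => //; exact: fimfunP.
Qed.

Let measurable_sigma n j : measurable (D `&` sigma n @^-1` [set j]).
Proof.
case: j => k y.
have -> : D `&` sigma n @^-1` [set (k, y)] =
    (\bigcup_(i in [set i | minn i n = k]) (D `&` kappa @^-1` [set i])) `&`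
    hn n @^-1` [set y].
  apply/seteqP; split => t /=.
    by move=> [Dt [kt yt]]; split => //; exists (kappa t).
  by move=> [[i /= ik [Dt /= ki]] yt]; split => //; rewrite /sigma ki ik yt.
apply: measurableI; first by apply: bigcup_measurable => i _; exact: mkappa.
by rewrite -[X in measurable X]setTI; apply: mhn.
Qed.

Let simple_approx n : simple_fun E D (approx n).
Proof.
apply: (simple_fun_comp (@finite_sigma n) (@measurable_sigma n)
  (phi := fun j => \sum_(k < n) coef k j *: v k)) => j.
by apply: elts_sum => // k _; exact: eltsZ.
Qed.

Let b k := fine (nrm E (v k)).

Let bE k : (b k)%:E = nrm E (v k).
Proof. by rewrite fineK// ge0_fin_numE ?(nrm_ge0 nE)// (nrm_lty nE). Qed.

Let b_ge0 k : 0 <= b k.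
Proof. by rewrite fine_ge0// (nrm_ge0 nE). Qed.

(* Up to the norm of the vector, the distance from the layered function to its
   approximation: the defect of [hn] on the layers kept, all of [h] on the others. *)
Let err n t : R := (h t - trunc n t) * b (kappa t).

Let trunc_ge0 n t : 0 <= trunc n t. Proof. by rewrite /trunc; case: ifP. Qed.

Let trunc_le n t : trunc n t <= h t. Proof. by rewrite /trunc; case: ifP. Qed.

Let err_ge0 n t : 0 <= err n t.
Proof. by rewrite mulr_ge0// subr_ge0. Qed.

Let err_le n t : err n t <= h t * b (kappa t).
Proof. by rewrite ler_wpM2r// lerBlDr lerDl. Qed.

Let err_cvg t : err n t @[n --> \oo] --> (0 : R).
Proof.
rewrite -[X in _ --> X](mul0r (b (kappa t))); apply: cvgMl.
rewrite -(subrr (h t)); apply: cvgB; first exact: cvg_cst.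
apply: cvg_trans (@hn_cvg t); apply: near_eq_cvg; near=> n.
rewrite /trunc ifT//; near: n; exact: nbhs_infty_gt.
Unshelve. all: by end_near. Qed.

Let nrm_err n t : (nrm E (h t *: v (kappa t) - approx n t)%R <= (err n t)%:E)%E.
Proof.
rewrite approxE -scalerBl (le_trans (nrmZ nE _ (Ev _)))//.
by rewrite ger0_norm ?subr_ge0// -bE.
Qed.

Lemma layered_strongly_measurable :
  strongly_measurable E D (fun t => h t *: v (kappa t)).
Proof.
split; first by move=> t _; exact: eltsZ.
exists approx; split; first exact: simple_approx.
apply/aeW => t Dt.
apply: (@squeeze_cvge _ _ _ _ (cst 0%E) _ (fun n => (err n t)%:E)); last 2 first.
- exact: cvg_cst.
- by apply/fine_cvgP; split; [exact: nearW|exact: err_cvg].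
apply: nearW => n; rewrite (nrm_ge0 nE)/= -opprB.
by rewrite nrmN//; apply: eltsB => //; [exact: eltsZ|rewrite approxE; exact: eltsZ].
Qed.

Hypothesis mass_lty : forall k,
  (\int[mu]_(t in D `&` kappa @^-1` [set k]) (h t)%:E < +oo)%E.

Let layer k := D `&` kappa @^-1` [set k].

Let mass k := fine (\int[mu]_(t in layer k) (h t)%:E)%E.

Let massE k : (mass k)%:E = (\int[mu]_(t in layer k) (h t)%:E)%E.
Proof.
rewrite fineK// ge0_fin_numE//; first exact: mass_lty.
by apply: integral_ge0 => t _; rewrite lee_fin.
Qed.

Let mhD A (g : R -> R) : measurable_fun [set: R] g -> measurable_fun A (EFin \o g).
Proof. by move=> mg; apply/measurable_EFinP; exact: measurable_funTS. Qed.

Let mhnE A n : measurable_fun A (fun t => (hn n t)%:E).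
Proof. by apply: (mhD (g := hn n)); exact: mhn. Qed.

Let mhE' A : measurable_fun A (fun t => (h t)%:E).
Proof. by apply: (mhD (g := h)). Qed.

Let mass_hn_le n k : (\int[mu]_(t in layer k) (hn n t)%:E <= (mass k)%:E)%E.
Proof.
rewrite massE; apply: ge0_le_integral; first exact: mkappa.
- by move=> t _; rewrite lee_fin.
- exact: mhnE.
- exact: mhE'.
- by move=> t _; rewrite lee_fin.
Qed.

Let mass_hn n k := fine (\int[mu]_(t in layer k) (hn n t)%:E)%E.

Let mass_hnE n k : (mass_hn n k)%:E = (\int[mu]_(t in layer k) (hn n t)%:E)%E.
Proof.
rewrite fineK// ge0_fin_numE ?(le_lt_trans (mass_hn_le _ _)) ?ltry//.
by apply: integral_ge0 => t _; rewrite lee_fin.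
Qed.

Let coef_level_lty n k j : (k < n)%N -> coef k j != 0 ->
  (mu (D `&` sigma n @^-1` [set j]) < +oo)%E.
Proof.
case: j => i y kn; rewrite /coef/=; have [->|ik] := eqVneq i k; last by rewrite eqxx.
rewrite normr_eq0 => y0.
have [->|/set0P[t0 [_ [_ /= yt0]]]] := eqVneq (D `&` sigma n @^-1` [set (k, y)]) set0.
  by rewrite measure0.
have {}y0 : 0 < y by rewrite lt_neqAle eq_sym y0/= -yt0; exact: hn_ge0.
have sub : D `&` sigma n @^-1` [set (k, y)] `<=` layer k.
  move=> t [Dt [/= kt _]]; split => //=; move: kt.
  by case: (leqP (kappa t) n) => // _ nk; rewrite nk ltnn in kn.
have : (y%:E * mu (D `&` sigma n @^-1` [set (k, y)]) <= (mass k)%:E)%E.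
  apply: le_trans (mass_hn_le n k).
  rewrite -integral_cst//; last exact: measurable_sigma.
  apply: (@le_trans _ _ (\int[mu]_(t in D `&` sigma n @^-1` [set (k, y)]) (hn n t)%:E)%E).
    apply: ge0_le_integral; first exact: measurable_sigma.
    - by move=> t _; rewrite lee_fin ltW.
    - exact: measurable_cst.
    - exact: mhnE.
    - by move=> t [_ [_ <-]].
  apply: ge0_subset_integral; [exact: measurable_sigma|exact: mkappa|exact: mhnE| |exact: sub].
  by move=> t _; rewrite lee_fin.
rewrite -lee_pdivlMl// => /le_lt_trans; apply.
by rewrite -EFinM ltry.
Qed.

Let simple_integrable_approx n : simple_integrable D (approx n).
Proof.
apply: (simple_integrable_comp (@finite_sigma n) (@measurable_sigma n)
  (phi := fun j => \sum_(k < n) coef k j *: v k)) => j; apply: contraPP.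
move/negP; rewrite -leNgt leye_eq => /eqP muoo.
suff -> : \sum_(k < n) coef k j *: v k = 0 by rewrite eqxx.
apply: big1 => k _; have [->|ak0] := eqVneq (coef k j) 0; first by rewrite scale0r.
by have := coef_level_lty (ltn_ord k) ak0; rewrite muoo ltxx.
Qed.

Let simple_integral_approx n :
  simple_integral D (approx n) = \sum_(k < n) mass_hn n k *: v k.
Proof.
rewrite (simple_integral_lincomb (@finite_sigma n) (@measurable_sigma n))//; last first.
  exact: coef_level_lty.
apply: eq_bigr => k _; congr (_ *: _); congr fine.
rewrite integral_mkcond [RHS]integral_mkcond; apply: eq_integral => t _.
rewrite !patchE; case: ifPn => tD; case: ifPn => tk //.
- move: tk; rewrite inE => -[_ /= kt].
  rewrite /coef/= kt (minn_idPl _) ?(ltnW (ltn_ord k))// eqxx ger0_norm//.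
- rewrite /coef/=; case: eqP => // kt.
  suff : t \in layer k by rewrite (negbTE tk).
  rewrite inE; split; first exact: set_mem.
  move: kt => /=; case: (leqP (kappa t) n) => // _ nk.
  by have := ltn_ord k; rewrite -nk ltnn.
- by move: tk tD; rewrite inE => -[/mem_set ->].
Qed.

Hypothesis series_lty :
  (\sum_(k <oo) (\int[mu]_(t in D `&` kappa @^-1` [set k]) (h t)%:E) * nrm E (v k)
   < +oo)%E.

Let bigcup_layer : \bigcup_k layer k = D.
Proof.
by apply/seteqP; split => t /=; [move=> [k _ []]|move=> Dt; exists (kappa t)].
Qed.

Let trivIset_layer : trivIset setT layer.
Proof.
apply/trivIsetP => i j _ _ ij; apply/seteqP; split => // t [[_ /= ti] [_ /= tj]].
by move: ij; rewrite -ti -tj eqxx.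
Qed.

Let mb : measurable_fun D (fun t => (b (kappa t))%:E).
Proof.
rewrite -bigcup_layer; apply/measurable_fun_bigcup => k; first exact: mkappa.
apply: (@eq_measurable_fun _ _ _ _ _ (cst (b k)%:E)) => //.
by move=> t; rewrite inE => -[_ /= ->].
Qed.

Let integrable_dom : mu.-integrable D (fun t => (h t * b (kappa t))%:E).
Proof.
apply/integrableP; split.
  by under eq_fun do rewrite EFinM; apply: emeasurable_funM; [exact: mhE'|exact: mb].
have -> : (\int[mu]_(t in D) `|(h t * b (kappa t))%:E| =
    \int[mu]_(t in \bigcup_k layer k) ((h t)%:E * (b (kappa t))%:E))%E.
  rewrite bigcup_layer; apply: eq_integral => t _.
  by rewrite gee0_abs ?lee_fin ?mulr_ge0// EFinM.
rewrite ge0_integral_bigcup; last 4 first.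
- by move=> k; exact: mkappa.
- by rewrite bigcup_layer; apply: emeasurable_funM; [exact: mhE'|exact: mb].
- by move=> t _; rewrite -EFinM lee_fin mulr_ge0.
- exact: trivIset_layer.
rewrite (eq_eseriesr (g := fun k =>
  ((\int[mu]_(t in layer k) (h t)%:E) * nrm E (v k))%E))// => k _.
have -> : (\int[mu]_(t in layer k) ((h t)%:E * (b (kappa t))%:E) =
    \int[mu]_(t in layer k) ((h t)%:E * (b k)%:E))%E.
  by apply: eq_integral => t; rewrite inE => -[_ /= ->].
rewrite ge0_integralZr; [by rewrite bE|exact: mkappa|exact: mhE'| |].
  by move=> t _; rewrite lee_fin.
by rewrite lee_fin.
Qed.

Let mtrunc n : measurable_fun D (fun t => (trunc n t)%:E).
Proof.
rewrite -bigcup_layer; apply/measurable_fun_bigcup => k; first exact: mkappa.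
apply: (@eq_measurable_fun _ _ _ _ _ (fun t => if (k < n)%N then (hn n t)%:E else 0%E)).
  by move=> t; rewrite inE /trunc => -[_ /= ->]; case: ifP.
by case: (k < n)%N; [exact: mhnE|exact: measurable_cst].
Qed.

Let merr n : measurable_fun D (fun t => (err n t)%:E).
Proof.
under eq_fun do rewrite EFinM EFinB.
apply: emeasurable_funM; last exact: mb.
by apply: emeasurable_funB; [exact: mhE'|exact: mtrunc].
Qed.

Let integral_err_cvg : (\int[mu]_(t in D) (err n t)%:E)%E @[n --> \oo] --> 0%E.
Proof.
have -> : 0%E = (\int[mu]_(t in D) (cst 0%E t))%E by rewrite integral0.
apply: (@dominated_cvg _ _ _ mu D mD (fun n t => (err n t)%:E) (cst 0%E)
  (fun t => (h t * b (kappa t))%:E)) => //.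
- by move=> t Dt; apply/fine_cvgP; split; [exact: nearW|exact: err_cvg].
- by move=> n t Dt; rewrite gee0_abs lee_fin.
Qed.

(* The coefficients of the first [n] vectors in the integral of the approximation
   differ from the masses of the layers by the defect of [hn], which [err] contains. *)
Let sum_mass_err n :
  (\sum_(k < n) ((mass k - mass_hn n k) * b k)%:E <= \int[mu]_(t in D) (err n t)%:E)%E.
Proof.
rewrite (eq_bigr (fun k : 'I_n => \int[mu]_(t in layer k) (err n t)%:E)%E); last first.
  move=> k _.
  have -> : (\int[mu]_(t in layer k) (err n t)%:E =
      \int[mu]_(t in layer k) (((h t)%:E - (hn n t)%:E) * (b k)%:E))%E.
    apply: eq_integral => t; rewrite inE => -[_ /= kt].
    by rewrite /err /trunc kt ltn_ord EFinM EFinB.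
  rewrite ge0_integralZr; last 4 first.
  - exact: mkappa.
  - by apply: emeasurable_funB; [exact: mhE'|exact: mhnE].
  - by move=> t _; rewrite -EFinB lee_fin subr_ge0.
  - by rewrite lee_fin.
  rewrite integralB; last 3 first.
  - exact: mkappa.
  - apply/integrableP; split; first exact: mhE'.
    under eq_integral do rewrite gee0_abs ?lee_fin//.
    exact: mass_lty.
  - apply/integrableP; split; first exact: mhnE.
    under eq_integral do rewrite gee0_abs ?lee_fin//.
    by rewrite (le_lt_trans (mass_hn_le _ _))// ltry.
  by rewrite -massE -mass_hnE.
apply: (@le_trans _ _ (\int[mu]_(t in \big[setU/set0]_(k < n) layer k) (err n t)%:E)%E).
  rewrite -(big_mkord xpredT layer) ge0_integral_bigsetU ?iota_uniq//.
  - by rewrite big_mkord.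
  - exact: sub_trivIset trivIset_layer.
  - apply: measurable_funS (merr n) => //.
    by rewrite -[X in _ `<=` X]bigcup_layer big_mkord -bigcup_mkord; exact: bigcup_subset.
  - by move=> t _; rewrite lee_fin.
apply: ge0_subset_integral; [|exact: mD|exact: merr| |].
- by apply: bigsetU_measurable => k _; exact: mkappa.
- by move=> t _; rewrite lee_fin.
- by rewrite -[X in _ `<=` X]bigcup_layer -bigcup_mkord; exact: bigcup_subset.
Qed.

(** Absolute convergence of the series makes [h t * nrm E (v (kappa t))]
    integrable; it dominates the error of the approximation. *)
Lemma layered_bochner_integral f : elts E f ->
  (nrm E ((\sum_(k < n)
    fine (\int[mu]_(t in D `&` kappa @^-1` [set k : nat]) (h t)%:E)%E *: v k) - f)%R
    @[n --> \oo] --> 0%E) ->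
  has_bochner_integral E D (fun t => h t *: v (kappa t)) f.
Proof.
move=> Ef vf; split => //; first exact: layered_strongly_measurable.
exists approx; split.
- by move=> n; split; [exact: simple_approx|exact: simple_integrable_approx].
- apply: (@squeeze_cvge _ _ _ _ (cst 0%E) _
    (fun n => \int[mu]_(t in D) (err n t)%:E)%E) => //; last exact: cvg_cst.
  apply: nearW => n; apply/andP; split.
    by apply: integral_ge0 => t _; exact: nrm_ge0.
  apply: ge0_le_lower_integral => [//|t _|t _|t _].
  - exact: (nrm_ge0 nE).
  - by rewrite lee_fin.
  - exact: nrm_err.
- apply: (@squeeze_cvge _ _ _ _ (cst 0%E) _
    (fun n => \int[mu]_(t in D) (err n t)%:E + nrm E ((\sum_(k < n) mass k *: v k) - f)%R)%E).
  + apply: nearW => n; rewrite (nrm_ge0 nE)/= simple_integral_approx.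
    have ES c : elts E (\sum_(k < n) c k *: v k).
      by apply: elts_sum => // k _; exact: eltsZ.
    rewrite -(subrKA (\sum_(k < n) mass k *: v k)) (le_trans (nrmD nE _ _))//; [exact: eltsB..|].
    rewrite leeD2r// (le_trans _ (sum_mass_err n))//.
    rewrite -sumrB (le_trans (nrm_sum nE _ _))//.
      by move=> k _; apply: eltsB => //; exact: eltsZ.
    apply: lee_sum => k _; rewrite -scalerBl (le_trans (nrmZ nE _ (Ev k)))//.
    rewrite EFinM bE lee_wpmul2r ?(nrm_ge0 nE)// lee_fin distrC ger0_norm// subr_ge0.
    by rewrite -lee_fin mass_hnE.
  + exact: cvg_cst.
  + rewrite -[X in _ --> X](adde0 0%E); apply: cvgeD => //; exact: integral_err_cvg.
Qed.

End layered.

(** * Weighted essential suprema and weight functions *)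

Section essential_supremum.
Set Implicit Arguments.
Unset Strict Implicit.
Context {R : realType}.
Local Notation mu := (@lebesgue_measure R).
Local Open Scope ereal_scope.
Implicit Types (g : R -> \bar R) (M : \bar R).

Lemma Linfty_normE g :
  Linfty_norm g = ess_sup mu (abse \o (g \_ `]0%R, +oo[%classic)).
Proof.
rewrite /Linfty_norm unlock /=.
have -> : 0 < mu [set: R].
  apply: (@lt_le_trans _ _ (mu `[0%R, 1%R]%classic)).
    by rewrite lebesgue_measure_itv/= lte_fin ltr01 oppr0 adde0 lte_fin.
  by apply: le_measure; rewrite ?inE.
by [].
Qed.

Lemma Linfty_norm_ge0 g : 0 <= Linfty_norm g.
Proof. by rewrite /Linfty_norm Lnorm_ge0. Qed.

Lemma Linfty_norm_le g M : 0 <= M ->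
  {ae mu, forall t, (0 < t)%R -> `|g t| <= M} -> Linfty_norm g <= M.
Proof.
move=> M0 gM; rewrite Linfty_normE; apply/ess_supP.
apply: ae_lebesgueS gM => t gtM /=; rewrite patchE; case: ifPn => [|_].
  by rewrite inE/= in_itv/= andbT => /gtM.
by rewrite abse0.
Qed.

Lemma Linfty_norm_ae g : {ae mu, forall t, (0 < t)%R -> `|g t| <= Linfty_norm g}.
Proof.
rewrite Linfty_normE.
have := @ess_sup_ge _ _ _ mu (abse \o (g \_ `]0%R, +oo[%classic)).
apply: ae_lebesgueS => t /= + t0; rewrite patchE mem_set//=.
by rewrite in_itv/= andbT.
Qed.

Lemma ae_itv_ex (P : R -> Prop) (x y : R) : (x < y)%R ->
  {ae mu, forall t, P t} -> exists t, [/\ (x < t)%R, (t < y)%R & P t].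
Proof.
move=> xy [N [mN muN PN]]; apply: contrapT => nP.
have : mu `]x, y[%classic <= mu N.
  apply: le_measure; rewrite ?inE// => t /=; rewrite in_itv/= => /andP[xt ty].
  by apply: PN => /= Pt; apply: nP; exists t.
by rewrite muN lebesgue_measure_itv/= lte_fin xy -EFinB lee_fin leNgt subr_gt0 xy.
Qed.

End essential_supremum.

Section half_line_integrals.
Set Implicit Arguments.
Unset Strict Implicit.
Context {R : realType}.
Local Notation mu := (@lebesgue_measure R).
Variables (g : R -> R).
Hypotheses (mg : measurable_fun [set: R] g) (g0 : forall t, 0 <= g t).

Let mgE A : measurable_fun A (fun t => (g t)%:E).
Proof. by apply/measurable_EFinP; exact: measurable_funTS. Qed.

Lemma integral_0c_le (t M : R) : 0 < t ->
  (forall x : R, 0 < x -> x <= t -> (\int[mu]_(s in `]x, t]%classic) (g s)%:E <= M%:E)%E) ->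
  (\int[mu]_(s in `]0%R, t]%classic) (g s)%:E <= M%:E)%E.
Proof.
move=> t0 gM.
pose F n : set R := `](n.+1%:R^-1), t]%classic.
have FE : \bigcup_n F n = `]0, t]%classic.
  apply/seteqP; split => s /=.
    move=> [n _]; rewrite /F/= !in_itv/= => /andP[ns ->].
    by rewrite (lt_trans _ ns)// invr_gt0 ltr0n.
  rewrite in_itv/= => /andP[s0 st].
  have /filter_ex[n [ns _]] := near_exhaust 0 s0.
  by exists n => //; rewrite /F/= in_itv/= ns.
have cvgF : (\int[mu]_(s in F n) (g s)%:E)%E @[n --> \oo] -->
    (\int[mu]_(s in \bigcup_n F n) (g s)%:E)%E.
  apply: ge0_nondecreasing_set_cvg_integral.
  - move=> m n mn; apply/subsetPset; apply: subset_itvr; rewrite bnd_simp.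
    by rewrite lef_pV2 ?posrE ?ltr0n// ler_nat.
  - by move=> n; exact: measurable_itv.
  - by move=> n; exact: mgE.
  - by move=> n s _; rewrite lee_fin.
rewrite -FE -(cvg_lim _ cvgF)//; apply: lime_le.
  by apply/cvg_ex; eexists; exact: cvgF.
near=> n; apply: gM; first by rewrite invr_gt0 ltr0n.
near: n; near=> n; apply: ltW; near: n.
by apply: filterS (near_exhaust 0 t0) => n [].
Unshelve. all: by end_near. Qed.

Lemma integral_cy_le (t M : R) : 0 < t ->
  (forall y : R, t <= y -> (\int[mu]_(s in `]t, y]%classic) (g s)%:E <= M%:E)%E) ->
  (\int[mu]_(s in `]t, +oo[%classic) (g s)%:E <= M%:E)%E.
Proof.
move=> t0 gM.
pose F n : set R := `]t, n.+1%:R]%classic.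
have FE : \bigcup_n F n = `]t, +oo[%classic.
  apply/seteqP; split => s /=.
    by move=> [n _]; rewrite /F/= !in_itv/= andbT => /andP[].
  rewrite in_itv/= andbT => ts.
  have /filter_ex[n [_ ns]] := near_exhaust s t0.
  by exists n => //; rewrite /F/= in_itv/= ts ltW.
have cvgF : (\int[mu]_(s in F n) (g s)%:E)%E @[n --> \oo] -->
    (\int[mu]_(s in \bigcup_n F n) (g s)%:E)%E.
  apply: ge0_nondecreasing_set_cvg_integral.
  - move=> m n mn; apply/subsetPset; apply: subset_itvl; rewrite bnd_simp.
    by rewrite ler_nat.
  - by move=> n; exact: measurable_itv.
  - by move=> n; exact: mgE.
  - by move=> n s _; rewrite lee_fin.
rewrite -FE -(cvg_lim _ cvgF)//; apply: lime_le.
  by apply/cvg_ex; eexists; exact: cvgF.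
near=> n; apply: gM.
near: n; near=> n; apply: ltW; near: n.
by apply: filterS (near_exhaust t t0) => n [].
Unshelve. all: by end_near. Qed.

End half_line_integrals.

Section weights.
Set Implicit Arguments.
Unset Strict Implicit.
Context {R : realType}.
Local Notation mu := (@lebesgue_measure R).
Implicit Types (f B : R -> R) (x y : R).

Lemma AC_pos_continuous f x : AC_pos f -> 0 < x -> {for x, continuous f}.
Proof.
move=> acf x0; apply/cvgrPdist_lt => e e0.
have x2 : 0 < x / 2 by rewrite divr_gt0.
have x22 : x / 2 <= x + x by lra.
have [d d0 fd] := acf _ _ x2 x22 _ e0.
have main (y z : R) : x / 2 <= y -> y <= z -> z <= x + x -> z - y < d ->
    `|f z - f y| < e.
  move=> xy yz zx zyd; have := fd 1%N (fun=> y) (fun=> z); rewrite !big_ord1; apply => //.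
  by apply/trivIsetP => i j _ _; rewrite !ord1 eqxx.
near=> y.
have yx : `|x - y| < d by near: y; apply: cvgr_dist_lt => //; exact: cvg_id.
have yx2 : `|x - y| < x / 2 by near: y; apply: cvgr_dist_lt => //; exact: cvg_id.
move: yx2; rewrite ltr_norml => /andP[l u].
have [xy|yx'] := leP x y.
  rewrite distrC; apply: main => //; [by lra|by lra|].
  by apply: le_lt_trans yx; rewrite distrC ler_norm.
apply: main => //; [by lra|exact: ltW|by lra|].
by apply: le_lt_trans yx; rewrite ler_norm.
Unshelve. all: by end_near. Qed.

Lemma AC_pos_opp f : AC_pos f -> AC_pos (fun x => - f x).
Proof.
move=> acf x y x0 xy e e0; have [d d0 fd] := acf x y x0 xy e e0.
exists d => // n l r lr tlr lrd; rewrite (eq_bigr (fun i => `|f (r i) - f (l i)|)).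
  exact: fd.
by move=> i _; rewrite opprK addrC distrC.
Qed.

Lemma AC_pos_inv B : AC_pos B -> (forall x, 0 < x -> 0 < B x) ->
  nonincreasing_pos B -> AC_pos (fun x => (B x)^-1).
Proof.
move=> acB B0 ndB x y x0 xy e e0.
have y0 : 0 < y by exact: lt_le_trans xy.
have By2 : 0 < B y ^+ 2 by rewrite exprn_gt0// B0.
have [d d0 Bd] := acB x y x0 xy (e * B y ^+ 2) (mulr_gt0 e0 By2).
exists d => // n l r lr tlr lrd.
have {Bd} := Bd n l r lr tlr lrd; rewrite -ltr_pdivrMr//; apply: le_lt_trans.
rewrite mulr_suml; apply: ler_sum => i _; have [xl lri ry] := lr i.
have l0 : 0 < l i by exact: lt_le_trans xl.
have r0 : 0 < r i by exact: lt_le_trans lri.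
have Bl := B0 _ l0; have Br := B0 _ r0; have By := B0 _ y0.
have -> : (B (r i))^-1 - (B (l i))^-1 = - (B (r i) - B (l i)) / (B (r i) * B (l i)).
  by field; rewrite !gt_eqF.
rewrite normrM normrN normfV (gtr0_norm (mulr_gt0 Br Bl)).
apply: ler_wpM2l => //; rewrite lef_pV2 ?posrE ?mulr_gt0// expr2.
apply: ler_pM; [exact: ltW|exact: ltW|exact: ndB|].
by apply: ndB => //; exact: le_trans ry.
Qed.

(** Slow variation with exponent 1/2, squared: the form in which it is used to
    compare ratios of arguments with ratios of values of [B]. *)
Lemma SV_sqr_le B : SV B -> exists2 K : R, 0 < K & forall x y, 0 < x -> x <= y ->
  x * B x ^+ 2 <= K * (y * B y ^+ 2).
Proof.
move=> [B0 _ /(_ 2^-1)]; rewrite invr_gt0 ltr0n => /(_ isT)[[g [g0 ndg]]].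
move=> [[c c0 Bg] [c' c'0 gB]] _.
exists ((c * c') ^+ 2) => [|x y x0 xy]; first by rewrite exprn_gt0// mulr_gt0.
have y0 : 0 < y by exact: lt_le_trans xy.
have sq z : 0 < z -> z * B z ^+ 2 = (z `^ 2^-1 * B z) ^+ 2.
  move=> z0; rewrite exprMn; congr (_ * _).
  by rewrite -powR_mulrn ?powR_ge0// -powRrM mulVf ?pnatr_eq0// powRr1// ltW.
have h0 z : 0 < z -> 0 <= z `^ 2^-1 * B z.
  by move=> z0; rewrite mulr_ge0 ?powR_ge0// ltW// B0.
rewrite !sq// -exprMn ler_sqr ?nnegrE ?h0//; last first.
  by rewrite mulr_ge0 ?h0// ltW// mulr_gt0.
rewrite -mulrA (le_trans (Bg _ x0))// ler_wpM2l ?(ltW c0)//.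
by rewrite (le_trans (ndg _ _ x0 xy))// gB.
Qed.

Lemma level_ex B v : AC_pos B -> nonincreasing_pos B ->
  (forall e, 0 < e -> exists2 y, 1 <= y & B y < e) -> 0 < v -> v <= B 1 ->
  exists2 x, 1 <= x & B x = v.
Proof.
move=> acB ndB Boo v0 vB1; have [y y1 Byv] := Boo _ v0.
have [||x] := @IVT R B 1 y v y1.
- apply: continuous_in_subspaceT => x; rewrite inE/= in_itv/= => /andP[x1 _].
  by apply: AC_pos_continuous acB _; exact: lt_le_trans x1.
- by rewrite le_max vB1 ge_min (ltW Byv) orbT.
by rewrite in_itv/= => /andP[x1 _] Bx; exists x.
Qed.

(** The density [g] of [1/B] gives the J-weight [1 / (t * g t)]; the density [d]
    of [-B] has finite integral near infinity. They are derivatives almost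
    everywhere, so [d = g * B ^+ 2] by the quotient rule. *)
Lemma weight_densities B : AC_pos B -> (forall x, 0 < x -> 0 < B x) ->
  nonincreasing_pos B ->
  exists g d : R -> R, [/\
    [/\ measurable_fun [set: R] g, forall t, 0 <= g t & forall x y, 0 < x -> x <= y ->
      (\int[mu]_(t in `]x, y]%classic) (g t)%:E = ((B y)^-1 - (B x)^-1)%:E)%E],
    [/\ measurable_fun [set: R] d, forall t, 0 <= d t & forall x y, 0 < x -> x <= y ->
      (\int[mu]_(t in `]x, y]%classic) (d t)%:E = (B x - B y)%:E)%E] &
    {ae mu, forall t, 0 < t -> d t = g t * B t ^+ 2 /\
      J_weight B t = ((B t ^+ 2)%:E / (t * d t)%:E)%E}].
Proof.
move=> acB B0 ndB.
have ndV : nondecreasing_pos (fun x => (B x)^-1).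
  move=> x y x0 xy; have y0 : 0 < y by exact: lt_le_trans xy.
  by rewrite lef_pV2 ?posrE ?B0// ndB.
have ndN : nondecreasing_pos (fun x => - B x).
  by move=> x y x0 xy; rewrite lerN2 ndB.
have [g [mg g0 gE dg]] := AC_density ndV (AC_pos_inv acB B0 ndB).
have [d [md d0 dE dd]] := AC_density ndN (AC_pos_opp acB).
exists g, d; split; [by split|split => // x y x0 xy|].
  by rewrite dE// opprK addrC.
apply: ae_lebesgueS2 dg dd => t + + t0 => /(_ t0)[_ gt] /(_ t0)[dNB dt].
have dB : derivable B t 1 by rewrite -[B]opprK; exact: derivableN dNB.
have dN : 'D_1 (fun x => - B x) t = - 'D_1 B t := deriveN dB.
have BN : derive1 B t = - d t by rewrite -dt !derive1E dN opprK.
have B2 : B t ^+ 2 != 0 by rewrite expf_neq0// gt_eqF// B0.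
rewrite /J_weight BN opprK; split => //.
rewrite -gt derive1E deriveV ?gt_eqF ?B0// -derive1E BN.
by rewrite /GRing.scale/= mulrNN mulrAC mulVf// mul1r.
Qed.

End weights.

(** * Continuous inclusions *)

Section continuous_inclusions.
Set Implicit Arguments.
Unset Strict Implicit.
Context {R : realType} {Z : topologicalLmodType R}.
Implicit Types (S T X Y : @nspace R Z) (C D : R).
Local Open Scope ereal_scope.

Definition space_le S T C := forall f, elts S f ->
  elts T f /\ nrm T f <= C%:E * nrm S f.

Lemma space_le_trans S T U C D : (0 <= D)%R ->
  space_le S T C -> space_le T U D -> space_le S U (D * C).
Proof.
move=> D0 ST TU f Sf; have [Tf fST] := ST f Sf; have [Uf fTU] := TU f Tf.
split => //; apply: (le_trans fTU).
by rewrite EFinM -muleA lee_wpmul2l.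
Qed.

Lemma eq_space_le S T C D : (0 < C)%R -> (0 < D)%R ->
  space_le S T C -> space_le T S D -> eq_space S T.
Proof.
move=> C0 D0 ST TS; split.
  by apply/seteqP; split => f; [move=> /ST[]|move=> /TS[]].
exists (D^-1)%R, C; split => // [|f Sf]; first by rewrite invr_gt0.
have [Tf fST] := ST f Sf; have [_ fTS] := TS f Tf; split => //.
by rewrite lee_pdivrMl.
Qed.

Lemma sum_space_le X S T C : (1 <= C)%R -> (forall f, 0 <= nrm X f) ->
  (forall f, 0 <= nrm S f) ->
  space_le S T C -> space_le (sum_space X S) (sum_space X T) C.
Proof.
move=> C1 X0 S0 ST f [[p q] fpq]; split.
  by case: fpq => /= Xp Sq fE; exists (p, q); split => //=; have [] := ST q Sq.
apply: lee_ereal_infZ; first exact: le_trans C1.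
  by exists (nrm X p + nrm S q); exists (p, q).
move=> _ [[a b] /= [/= Xa Sb fE] <-]; have [Tb STb] := ST b Sb.
apply: ge_ereal_inf; exists (nrm X a + nrm T b); first by exists (a, b).
rewrite ge0_muleDr// leeD//.
by rewrite -[leLHS]mul1e lee_wpmul2r.
Qed.

End continuous_inclusions.

(** Bounds on a weighted quantity are bounds by the reciprocal of the weight. Where
    [g] vanishes the weight is infinite, and both bounds say that [j = 0]. *)
Section weight_inversion.
Set Implicit Arguments.
Unset Strict Implicit.
Context {R : realType}.
Variables (B2 t g d : R).
Hypotheses (B2_gt0 : 0 < B2) (t_gt0 : 0 < t) (g_ge0 : 0 <= g) (dE : d = g * B2).
Local Open Scope ereal_scope.

Let weightE : (0 < g)%R -> B2%:E / (t * d)%:E = ((t * g)^-1)%:E.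
Proof.
move=> g0; rewrite inver dE ifF; last by rewrite !mulf_eq0 !gt_eqF.
by rewrite -EFinM; congr EFin; field; rewrite !gt_eqF.
Qed.

Let weight0 : g = 0%R -> B2%:E / (t * d)%:E = +oo.
Proof. by move=> g0; rewrite dE g0 mul0r mulr0 inve0 gt0_muley// lte_fin. Qed.

Lemma weight_mul_le (c : R) (j : \bar R) : (0 <= c)%R -> 0 <= j ->
  j <= (c * (t * g))%:E -> `|B2%:E / (t * d)%:E * j| <= c%:E.
Proof.
move=> c0 j0; move: g_ge0; rewrite le_eqVlt => /predU1P[/esym g0|g0].
  rewrite g0 !mulr0 => j_le0; have -> : j = 0 by apply/eqP; rewrite eq_le j_le0.
  by rewrite mule0 abse0 lee_fin.
rewrite weightE// gee0_abs; last first.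
  by rewrite mule_ge0// lee_fin invr_ge0 mulr_ge0 ?ltW.
by rewrite lee_pdivrMl ?mulr_gt0// -EFinM mulrC.
Qed.

Lemma le_weight_mul (c : R) (j : \bar R) : 0 <= j ->
  `|B2%:E / (t * d)%:E * j| <= c%:E -> j <= (c * (t * g))%:E.
Proof.
move=> j0; move: g_ge0; rewrite le_eqVlt => /predU1P[/esym g0|g0].
  rewrite weight0// g0 !mulr0; move: j0; rewrite le_eqVlt => /predU1P[<- //|j0].
  by rewrite gt0_mulye//= leye_eq.
rewrite weightE// gee0_abs; last first.
  by rewrite mule_ge0// lee_fin invr_ge0 mulr_ge0 ?ltW.
by rewrite lee_pdivrMl ?mulr_gt0// -EFinM mulrC.
Qed.

End weight_inversion.

Section J_into_K.
Set Implicit Arguments.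
Unset Strict Implicit.
Context {R : realType} {Z : topologicalLmodType R}.
Local Notation mu := (@lebesgue_measure R).
Variables (X Y : @nspace R Z) (B : R -> R) (A : R -> \bar R) (K : R).
Hypotheses (nX : seminormed X) (nY : seminormed Y)
  (B_gt0 : forall x, 0 < x -> 0 < B x) (ndB : nonincreasing_pos B)
  (acB : AC_pos B) (K_gt0 : 0 < K)
  (B_sqr : forall x y, 0 < x -> x <= y -> x * B x ^+ 2 <= K * (y * B y ^+ 2))
  (A_def : {ae mu, forall x : R, 0 < x -> A x = J_weight B x}).

(** [K(f, t)] is at most the integral of [K(u s / s, t)], which is bounded by
    [L * g s] for [s <= t], and for [s > t] by
    [(t / s) * L * g s <= K * L / B t ^+ 2 * d s]. *)
Lemma J_repr_Kfun_le f u (L t : R) : J_repr X Y f u -> 0 <= L ->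
  {ae mu, forall s : R, 0 < s -> (`|A s * Jfun X Y (u s) s| <= L%:E)%E} -> 0 < t ->
  ((B t)%:E * Kfun X Y f t <= ((1 + K) * L)%:E)%E.
Proof.
move=> [[uE _] bu] L0 AJ t0.
have [g [d [[mg g0 gE] [md d0 dE] gdE]]] := weight_densities acB B_gt0 ndB.
have Bt := B_gt0 t0.
pose D : set R := `]0, +oo[%classic.
have DP s : D s = (0 < s) :> Prop by rewrite /D/= in_itv/= andbT.
pose c := K * L / B t ^+ 2.
have c0 : 0 <= c by rewrite divr_ge0 ?mulr_ge0 ?(ltW K_gt0) ?exprn_ge0 ?(ltW Bt).
have mgE A' : measurable_fun A' (fun s => (L * g s)%:E).
  by apply/measurable_EFinP; apply: measurable_funM => //; exact: measurable_funTS.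
have mdE A' : measurable_fun A' (fun s => (c * d s)%:E).
  by apply/measurable_EFinP; apply: measurable_funM => //; exact: measurable_funTS.
pose G s := if s <= t then (L * g s)%:E else (c * d s)%:E.
have G0 s : D s -> (0 <= G s)%E.
  by move=> _; rewrite /G; case: ifP => _; rewrite lee_fin mulr_ge0.
have DE : D = `]0, t]%classic `|` `]t, +oo[%classic.
  apply/seteqP; split => s; rewrite DP/= !in_itv/= ?andbT.
    by move=> s0; case: (leP s t) => st; [left; rewrite s0|right].
  by case=> [/andP[]//|]; exact: lt_trans.
have mG : measurable_fun D G.
  rewrite DE; apply/measurable_funU => //; split.
  - apply: (@eq_measurable_fun _ _ _ _ _ (fun s => (L * g s)%:E)) => [s|]; last exact: mgE.
    by rewrite inE/= in_itv/= /G => /andP[_ ->].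
  - apply: (@eq_measurable_fun _ _ _ _ _ (fun s => (c * d s)%:E)) => [s|]; last exact: mdE.
    by rewrite inE/= in_itv/= andbT /G => ts; rewrite leNgt ts.
have Kle : (Kfun X Y f t <= \int[mu]_(s in D) G s)%E.
  have max0 : 0 < Num.max 1 t by rewrite lt_max ltr01.
  apply: (nrm_bochner_le (p := NSpace (elts (sum_space X Y)) (fun f => Kfun X Y f t))
    (sum_seminormed nX nY) (Kfun_seminormed nX nY (ltW t0)) max0 _ _ _ bu mG G0) => //.
  - by move=> z; exact: Kfun_le_nrm.
  apply: ae_lebesgueS2 (ae_lebesgueS2 _ A_def AJ) gdE; last exact: (fun t Pt Qt => conj Pt Qt).
  move=> s [/= As AJs] gds Ds; have s0 : 0 < s by rewrite -DP; exact: Ds.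
  have [Xus Yus] : elts (cap_space X Y) (u s).
    exact: uE.
  have [ds AE] := gds s0; have Bs := B_gt0 s0.
  have Jle : (Jfun X Y (u s) s <= (L * (s * g s))%:E)%E.
    apply: (le_weight_mul (B2 := B s ^+ 2) (d := d s)) => //.
    + exact: exprn_gt0.
    + exact: Jfun_ge0.
    + by rewrite -AE -As//; exact: AJs.
  have nK := Kfun_seminormed nX nY (ltW t0).
  have sumu : elts (sum_space X Y) (u s) by exact: elts_suml.
  rewrite (le_trans (nrmZ nK s^-1 sumu))//= ger0_norm ?invr_ge0 ?(ltW s0)//.
  rewrite lee_pdivrMl//.
  rewrite /G; case: (leP s t) => st.
    rewrite (le_trans (Kfun_le_l nY t Xus))// -EFinM mulrCA.
    by apply: le_trans Jle; rewrite le_max lexx.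
  rewrite (le_trans (Kfun_le_r nX t Yus))//.
  have -> : (t%:E * nrm Y (u s) = (t / s)%:E * (s%:E * nrm Y (u s)))%E.
    by rewrite muleA -EFinM divfK// gt_eqF.
  have J2 : (s%:E * nrm Y (u s) <= (L * (s * g s))%:E)%E.
    by apply: le_trans Jle; rewrite le_max lexx orbT.
  apply: (le_trans (lee_wpmul2l _ J2)); first by rewrite lee_fin divr_ge0 ?ltW.
  rewrite -!EFinM lee_fin ds /c.
  have -> : t / s * (L * (s * g s)) = L * g s * t by field; rewrite gt_eqF.
  have -> : s * (K * L / B t ^+ 2 * (g s * B s ^+ 2)) =
      L * g s * (K * (s * B s ^+ 2) / B t ^+ 2) by field; rewrite gt_eqF.
  by rewrite ler_wpM2l ?mulr_ge0// ler_pdivlMr ?exprn_gt0// B_sqr// ltW.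
have intG : (\int[mu]_(s in D) G s <= (L / B t + c * B t)%:E)%E.
  rewrite DE ge0_integral_setU; last 5 first.
  - exact: measurable_itv.
  - exact: measurable_itv.
  - by rewrite -DE.
  - by move=> s; rewrite -DE; exact: G0.
  - apply/disj_setPS => s [] /=; rewrite !in_itv/= andbT => /andP[_ st] ts.
    by rewrite ltNge st in ts.
  have mE h A' : measurable_fun [set: R] h -> measurable_fun A' (fun s => (h s)%:E).
    by move=> mh; apply/measurable_EFinP; exact: measurable_funTS.
  rewrite EFinD; apply: leeD.
  - have -> : (\int[mu]_(s in `]0%R, t]%classic) G s =
        \int[mu]_(s in `]0%R, t]%classic) (L%:E * (g s)%:E))%E.
      by apply: eq_integral => s; rewrite inE/= in_itv/= /G => /andP[_ ->].
    rewrite ge0_integralZl; last 4 first.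
    + exact: measurable_itv.
    + exact: mE.
    + by move=> s _; rewrite lee_fin.
    + by rewrite lee_fin.
    rewrite EFinM lee_wpmul2l//; apply: integral_0c_le => // x x0 xt.
    by rewrite gE// lee_fin lerBlDr lerDl invr_ge0 ltW// B_gt0.
  - have -> : (\int[mu]_(s in `]t, +oo[%classic) G s =
        \int[mu]_(s in `]t, +oo[%classic) (c%:E * (d s)%:E))%E.
      by apply: eq_integral => s; rewrite inE/= in_itv/= andbT /G => ts; rewrite leNgt ts.
    rewrite ge0_integralZl; last 4 first.
    + exact: measurable_itv.
    + exact: mE.
    + by move=> s _; rewrite lee_fin.
    + by rewrite lee_fin.
    rewrite (EFinM c (B t)) lee_wpmul2l//; apply: integral_cy_le => // y ty.
    by rewrite dE// lee_fin lerBlDr lerDl ltW// B_gt0// (lt_le_trans t0).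
rewrite -lee_pdivlMl//; apply: (le_trans Kle); apply: (le_trans intG).
rewrite -EFinM lee_fin /c le_eqVlt; apply/orP; left; apply/eqP.
by field; rewrite gt_eqF.
Qed.

Lemma J_space_le_K : space_le (J0oo X Y A) (K0oo X Y (EFin \o B)) (1 + K).
Proof.
move=> f [fE [u0 u0f] Jf].
have C0 : 0 < 1 + K by rewrite addr_gt0.
have le u : J_repr X Y f u ->
    (Linfty_norm (fun t => (EFin \o B) t * Kfun X Y f t) <=
     (1 + K)%:E * Linfty_norm (fun t => A t * Jfun X Y (u t) t))%E.
  move=> uf; set L := Linfty_norm (fun t => A t * _)%E.
  have L0 : (0 <= L)%E := Linfty_norm_ge0 _.
  have [->|Loo] := eqVneq L +oo%E; first by rewrite gt0_muley ?leey// lte_fin.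
  have Lf : L \is a fin_num by rewrite ge0_fin_numE// ltey.
  apply: Linfty_norm_le; first by rewrite mule_ge0// lee_fin ltW.
  apply: aeW => t t0; rewrite gee0_abs.
    rewrite -(fineK Lf) -EFinM; apply: J_repr_Kfun_le uf _ _ t0; first exact: fine_ge0.
    by rewrite fineK//; exact: Linfty_norm_ae.
  rewrite mule_ge0//; first by rewrite lee_fin ltW// B_gt0.
  exact: (nrm_ge0 (Kfun_seminormed nX nY (ltW t0))).
have nle : (Linfty_norm (fun t => (EFin \o B) t * Kfun X Y f t) <=
    (1 + K)%:E * nrm (J0oo X Y A) f)%E.
  apply: lee_ereal_infZ; first exact: ltW.
    by eexists; exists u0 => //; exact: u0f.
  by move=> _ [u uf <-]; exact: le.
split; last by rewrite /= mem_set.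
split => //; apply: le_lt_trans nle _.
by rewrite lte_mul_pinfty// lee_fin ltW.
Qed.

End J_into_K.

(** [b] is bounded, which controls the part in [X], and dominated by [B], which
    controls the other part. *)
Section K_sum_into_K.
Set Implicit Arguments.
Unset Strict Implicit.
Context {R : realType} {Z : topologicalLmodType R}.
Variables (X Y : @nspace R Z) (b B : R -> R) (c C : R).
Hypotheses (nX : seminormed X) (nY : seminormed Y)
  (b_ge0 : forall t, 0 < t -> 0 <= b t) (B_ge0 : forall t, 0 < t -> 0 <= B t)
  (b_le : forall t, 0 < t -> b t <= C) (bB : forall t, 0 < t -> b t <= C * B t).

Lemma sum_K_space_le_K : 0 < C ->
  space_le (sum_space X (K0oo X Y (EFin \o B))) (K0oo X Y (EFin \o b)) C.
Proof.
move=> C0 f [[p0 q0] [/= Xp0 [q0E q0K] fE0]].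
have K0 g t : 0 < t -> (0 <= Kfun X Y g t)%E.
  by move=> t0; exact: (nrm_ge0 (Kfun_seminormed nX nY (ltW t0))).
have fE : elts (sum_space X Y) f.
  rewrite fE0; apply: (eltsD (sum_seminormed nX nY)) => //.
  exact: elts_suml.
have le p q : elts X p -> elts (sum_space X Y) q -> f = p + q ->
    (Linfty_norm (fun t => (EFin \o b) t * Kfun X Y f t) <=
     C%:E * (nrm X p + Linfty_norm (fun t => (EFin \o B) t * Kfun X Y q t)))%E.
  move=> Xp qE fpq; set L := Linfty_norm (fun t => _ * Kfun X Y q t)%E.
  have L0 : (0 <= L)%E := Linfty_norm_ge0 _.
  apply: Linfty_norm_le.
    by rewrite mule_ge0 ?adde_ge0 ?(nrm_ge0 nX)// lee_fin ltW.
  apply: ae_lebesgueS (Linfty_norm_ae (fun t => (EFin \o B) t * Kfun X Y q t)%E) => t.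
  move=> BK t0; have := BK t0; rewrite -/L.
  rewrite !gee0_abs ?mule_ge0 ?K0 ?lee_fin ?b_ge0 ?B_ge0//= => BKt.
  rewrite ge0_muleDr ?(nrm_ge0 nX)//.
  have nK := Kfun_seminormed nX nY (ltW t0).
  have Kf : (Kfun X Y f t <= nrm X p + Kfun X Y q t)%E.
    rewrite fpq (le_trans (nrmD nK (elts_suml nY Xp) qE))// leeD2r//=.
    exact: Kfun_le_l.
  rewrite (le_trans (lee_wpmul2l _ Kf)) ?lee_fin ?b_ge0//.
  rewrite ge0_muleDr ?(nrm_ge0 nX) ?K0// leeD//.
    by rewrite lee_wpmul2r ?(nrm_ge0 nX)// lee_fin b_le.
  rewrite (@le_trans _ _ (C%:E * ((B t)%:E * Kfun X Y q t))%E)//.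
    by rewrite muleA -EFinM lee_wpmul2r ?K0// lee_fin bB.
  by rewrite lee_wpmul2l// lee_fin ltW.
split.
  split => //; apply: le_lt_trans (le p0 q0 Xp0 q0E fE0) _.
  rewrite lte_mul_pinfty ?lee_fin ?ltW//.
  by rewrite lte_add_pinfty// (nrm_lty nX).
rewrite /= mem_set//; apply: lee_ereal_infZ; first exact: ltW.
  by eexists; exists (p0, q0).
by move=> _ [[p q] [/= Xp [qE qK] fpq] <-]; rewrite mem_set//; exact: le.
Qed.

End K_sum_into_K.

(** * Representation of the K-space by the J-method *)

Section K_into_sum_J.
Set Implicit Arguments.
Unset Strict Implicit.
Context {R : realType} {Z : topologicalLmodType R}.
Local Notation mu := (@lebesgue_measure R).
Variables (X Y : @nspace R Z) (B : R -> R) (A : R -> \bar R) (K : R).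
Hypotheses (nX : seminormed X) (nY : seminormed Y)
  (B_gt0 : forall x, 0 < x -> 0 < B x) (ndB : nonincreasing_pos B)
  (acB : AC_pos B) (K_gt0 : 0 < K)
  (B_sqr : forall x y, 0 < x -> x <= y -> x * B x ^+ 2 <= K * (y * B y ^+ 2))
  (A_def : {ae mu, forall x : R, 0 < x -> A x = J_weight B x}).

(** Nearly optimal decompositions [f = p k + q k] at the points where [B] has
    halved [k] times are joined into a representation of [q 1]. *)
Section chain.
Variables (x_ : nat -> R) (p q : nat -> Z) (f : Z) (M : R).
Hypotheses (M_gt0 : 0 < M) (x_ge1 : forall k, 1 <= x_ k)
  (Bx : forall k, B (x_ k) = B 1 / 2 ^+ k)
  (Xp : forall k, elts X (p k)) (Yq : forall k, elts Y (q k))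
  (fpq : forall k, f = p k + q k)
  (pq_le : forall k,
    (nrm X (p k) + (x_ k)%:E * nrm Y (q k) <= (2 * M * 2 ^+ k / B 1)%:E)%E).

Let B1_gt0 : 0 < B 1. Proof. exact: B_gt0. Qed.

Let pow2_gt0 k : 0 < 2 ^+ k :> R. Proof. by rewrite exprn_gt0. Qed.

Let x_gt0 k : 0 < x_ k. Proof. exact: lt_le_trans (x_ge1 k). Qed.

Let x_lt k : x_ k < x_ k.+1.
Proof.
rewrite ltNge; apply/negP => /(ndB (x_gt0 _)); apply/negP.
rewrite -ltNge !Bx ltr_pM2l// ltf_pV2 ?posrE// exprS ltr_pMl//.
by rewrite ltr1n.
Qed.

Let x_homo : {homo x_ : i j / (i <= j)%N >-> i <= j}.
Proof. by apply/nondecreasing_seqP => k; exact: ltW. Qed.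

Let x_cofinal s : 0 < s -> exists k, s <= x_ k.
Proof.
move=> s0; have Bs := B_gt0 s0.
have [k Bk] : exists k : nat, B 1 / 2 ^+ k < B s.
  have [k [_ kB]] : exists k : nat, k.+1%:R^-1 < s /\ B 1 / B s < k.+1%:R.
    by have /filter_ex[k] := near_exhaust (B 1 / B s) s0; exists k.
  exists k.+1; rewrite ltr_pdivrMr// -ltr_pdivrMl// mulrC.
  by apply: (lt_trans kB); rewrite -natrX ltr_nat ltn_expl.
exists k; rewrite leNgt; apply/negP => xs.
by have := ndB (x_gt0 k) (ltW xs); rewrite Bx leNgt Bk.
Qed.

(* The least index [k] with [s <= x_ k]: layer 0 is ]0, x_ 0], and layer
   k.+1 is ]x_ k, x_ k.+1]. *)
Let kappa s : nat :=
  if pselect (exists k, s <= x_ k) is left e then ex_minn e else 0%N.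

Let kappaP s : 0 < s -> s <= x_ (kappa s) /\ forall j, s <= x_ j -> (kappa s <= j)%N.
Proof.
move=> s0; rewrite /kappa; case: pselect => [e|]; last by have := x_cofinal s0.
by case: ex_minnP.
Qed.

Let D : set R := `]0, +oo[%classic.

Let DE s : D s = (0 < s) :> Prop. Proof. by rewrite /D/= in_itv/= andbT. Qed.

Let layer0 : D `&` kappa @^-1` [set 0%N] = `]0, x_ 0%N]%classic.
Proof.
apply/seteqP; split => s /=; rewrite in_itv/= ?andbT.
  by move=> [+ k0]; rewrite DE => s0; rewrite s0/=; have [+ _] := kappaP s0; rewrite k0.
move=> /andP[s0 sx]; split; first by rewrite DE.
by have [_ /(_ _ sx)] := kappaP s0; rewrite leqn0 => /eqP.
Qed.

Let layerS k : D `&` kappa @^-1` [set k.+1] = `]x_ k, x_ k.+1]%classic.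
Proof.
apply/seteqP; split => s /=; rewrite in_itv/= ?andbT.
  move=> [+ ks]; rewrite DE => s0; have [+ kmin] := kappaP s0; rewrite ks => ->.
  by rewrite andbT ltNge; apply/negP => /kmin; rewrite ks ltnn.
move=> /andP[xs sx]; have s0 : 0 < s by exact: lt_trans xs.
split; first by rewrite DE.
have [sk kmin] := kappaP s0.
apply/eqP; rewrite eqn_leq kmin//= ltnNge; apply/negP => /x_homo kx.
by have := le_trans sk kx; rewrite leNgt xs.
Qed.

Let mlayer k : measurable (D `&` kappa @^-1` [set k]).
Proof. by case: k => [|k]; rewrite ?layer0 ?layerS; exact: measurable_itv. Qed.

(* The increment of [1/B] over layer [k.+1]. *)
Let gap k : R := 2 ^+ k / B 1.

Let gap_gt0 k : 0 < gap k. Proof. by rewrite divr_gt0. Qed.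

(* The difference [q k - q k.+1] is carried by layer [k], which lies to the left of
   [x_ k]: the bound on [x_ k * nrm Y (q k)] then holds with any [s] of that layer
   in place of [x_ k]. On the layer that follows [x_ k] it would be lost. *)
Let v k : Z := if k is j.+1 then (gap j)^-1 *: (q j.+1 - q j.+2) else 0.

Let qp k : q k - q k.+1 = p k.+1 - p k.
Proof.
have qE j : q j = f - p j by rewrite {1}(fpq j) addrAC subrr add0r.
by rewrite !qE opprB addrC subrKA.
Qed.

Let Yv k : elts Y (v k).
Proof. by case: k => [|k] /=; [exact: elts0|apply: eltsZ => //; exact: eltsB]. Qed.

Let Xv k : elts X (v k).
Proof.
by case: k => [|k] /=; [exact: elts0|rewrite qp; apply: eltsZ => //; exact: eltsB].
Qed.

Let p_le k : (nrm X (p k) <= (2 * M * gap k)%:E)%E.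
Proof.
apply: le_trans (le_trans (pq_le k) _); last by rewrite lee_fin /gap mulrA.
by rewrite leeDl// mule_ge0 ?(nrm_ge0 nY)// lee_fin ltW.
Qed.

Let q_le k : ((x_ k)%:E * nrm Y (q k) <= (2 * M * gap k)%:E)%E.
Proof.
apply: le_trans (le_trans (pq_le k) _); last by rewrite lee_fin /gap mulrA.
by rewrite leeDr// (nrm_ge0 nX).
Qed.

Let gapS k : gap k.+1 = 2 * gap k. Proof. by rewrite /gap exprS mulrA. Qed.

(* With [d] the increment on the layer of [v k.+1], the decompositions at
   [x_ k.+1] and [x_ k.+2] cost at most [4 * M * d] and [8 * M * d]. *)
Let nrm_vX k : (nrm X (v k) <= (12 * M)%:E)%E.
Proof.
case: k => [|k] /=; first by rewrite (nrm0 nX) lee_fin mulr_ge0// ltW.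
rewrite qp (le_trans (nrmZ nX _ (eltsB nX (Xp _) (Xp _))))//.
rewrite ger0_norm ?invr_ge0 ?(ltW (gap_gt0 _))// lee_pdivrMl//.
rewrite (le_trans (nrmB nX (Xp _) (Xp _)))//.
rewrite (le_trans (leeD (p_le _) (p_le _)))//.
rewrite -EFinD -EFinM lee_fin !gapS; have := gap_gt0 k; lra.
Qed.

Let nrm_vY k s : 0 < s -> s <= x_ k -> (s%:E * nrm Y (v k) <= (12 * M)%:E)%E.
Proof.
case: k => [|k] /= s0 sx.
  by rewrite (nrm0 nY) mule0 lee_fin mulr_ge0// ltW.
have nv := nrmZ nY (gap k)^-1 (eltsB nY (Yq k.+1) (Yq k.+2)).
rewrite (le_trans (lee_wpmul2l _ nv)) ?lee_fin ?(ltW s0)//.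
rewrite ger0_norm ?invr_ge0 ?(ltW (gap_gt0 _))// muleCA lee_pdivrMl//.
rewrite (le_trans (lee_wpmul2l _ (nrmB nY (Yq _) (Yq _)))) ?lee_fin ?(ltW s0)//.
rewrite ge0_muleDr ?(nrm_ge0 nY)//.
have sq j : (k.+1 <= j)%N -> (s%:E * nrm Y (q j) <= (2 * M * gap j)%:E)%E.
  move=> kj; apply: le_trans (q_le j).
  by rewrite lee_wpmul2r ?(nrm_ge0 nY)// lee_fin (le_trans sx)// x_homo.
rewrite (le_trans (leeD (sq k.+1 _) (sq k.+2 _)))//.
rewrite -EFinD -EFinM lee_fin !gapS; have := gap_gt0 k; lra.
Qed.

(* Slow variation makes [x_ k] grow at least like [4 ^ k], whereas [x_ k] times the
   norm of [q k] is only bounded by a multiple of [2 ^ k]. *)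
Let nrm_q k : (nrm Y (q k) <= (2 * M * K / B 1 / 2 ^+ k)%:E)%E.
Proof.
have xk : 2 ^+ k * 2 ^+ k <= K * x_ k.
  have := B_sqr ltr01 (x_ge1 k); rewrite Bx mul1r expr_div_n mulrA mulrCA.
  rewrite -[leLHS]mulr1 ler_pM2l ?exprn_gt0// ler_pdivlMr ?exprn_gt0// mul1r.
  by rewrite -expr2.
rewrite -(@lee_pmul2l _ (x_ k)%:E) ?lte_fin// (le_trans (q_le k))//.
rewrite -EFinM lee_fin /gap.
have -> : 2 * M * (2 ^+ k / B 1) = (2 * M / B 1 / 2 ^+ k) * (2 ^+ k * 2 ^+ k).
  by field; rewrite !gt_eqF.
have -> : x_ k * (2 * M * K / B 1 / 2 ^+ k) = (2 * M / B 1 / 2 ^+ k) * (K * x_ k).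
  by field; rewrite !gt_eqF.
by rewrite ler_wpM2l// !mulr_ge0 ?invr_ge0 ?ltW.
Qed.

(** The function [s * h s *: v (kappa s)], with [h] the density of [1/B] beyond
    [x_ 0], represents [q 1]: its layers have integrals [q k - q k.+1], and the
    partial sums telescope to [q 1 - q n]. *)
Lemma chain_J_space :
  elts (J0oo X Y A) (q 1%N) /\ (nrm (J0oo X Y A) (q 1%N) <= (12 * M)%:E)%E.
Proof.
have [g [d [[mg g0 gE] _ gdE]]] := weight_densities acB B_gt0 ndB.
pose h s : R := g s * \1_(`]x_ 0%N, +oo[%classic) s.
have h0 s : 0 <= h s by rewrite mulr_ge0.
have hg s : x_ 0%N < s -> h s = g s.
  by move=> xs; rewrite /h indicE mem_set ?mulr1//= in_itv/= xs.
have h_0 s : s <= x_ 0%N -> h s = 0.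
  move=> sx; rewrite /h indicE memNset ?mulr0//= in_itv/= andbT.
  by rewrite ltNge sx.
have h_le s : h s <= g s.
  by rewrite /h -[leRHS]mulr1 ler_wpM2l// indicE lern1 leq_b1.
have mh : measurable_fun [set: R] h.
  by apply: measurable_funM => //; exact: measurable_indic.
pose u s := (s * h s) *: v (kappa s).
have h_neg s : s <= 0 -> h s = 0.
  by move=> s0; apply: h_0; apply: (le_trans s0); exact: ltW.
have sh0 s : 0 <= s * h s.
  by case: (leP s 0) => [/h_neg ->|s0]; rewrite ?mulr0// mulr_ge0// ltW.
have msh : measurable_fun [set: R] (fun s => s * h s) by exact: measurable_funM.
have nsum := sum_seminormed nX nY.
have ncap := cap_seminormed nX nY.
have mass0 : (\int[mu]_(s in D `&` kappa @^-1` [set 0%N]) (h s)%:E = 0)%E.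
  rewrite layer0 (eq_integral (cst 0%E)) ?integral0// => s.
  by rewrite inE/= in_itv/= => /andP[_ /h_0 ->].
have massS k : (\int[mu]_(s in D `&` kappa @^-1` [set k.+1]) (h s)%:E = (gap k)%:E)%E.
  rewrite layerS.
  have -> : (\int[mu]_(s in `]x_ k, x_ k.+1]%classic) (h s)%:E =
      \int[mu]_(s in `]x_ k, x_ k.+1]%classic) (g s)%:E)%E.
    apply: eq_integral => s; rewrite inE/= in_itv/= => /andP[xs _].
    by rewrite hg// (le_lt_trans _ xs)// x_homo.
  rewrite gE ?(ltW (x_lt k))// !Bx !invf_div -mulrBl exprS.
  by rewrite /gap; congr (_ / _)%:E; ring.
have repr : J_repr X Y (q 1%N) u.
  split; first by apply: layered_strongly_measurable => // k; split.
  have -> : (fun s => s^-1 *: u s) = (fun s => h s *: v (kappa s)).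
    apply/funext => s; rewrite /u scalerA mulrA.
    have [->|s0] := eqVneq s 0; first by rewrite h_neg// !mulr0 !scale0r.
    by rewrite mulVf// mul1r.
  apply: layered_bochner_integral => //.
  - by move=> k; exact: elts_sumr.
  - by case=> [|k]; rewrite ?mass0 ?massS ltry.
  - pose c := 4 * (2 * M * K / B 1).
    have c0 : 0 <= c by rewrite !mulr_ge0 ?invr_ge0 ?ltW.
    apply: le_lt_trans (ltry c); apply: le_trans (epsilon_trick0 xpredT c0).
    apply: lee_nneseries => k _.
      rewrite mule_ge0 ?(nrm_ge0 nsum)//.
      by apply: integral_ge0 => s _; rewrite lee_fin.
    case: k => [|k]; first by rewrite mass0 mul0e lee_fin divr_ge0.
    rewrite massS.
    have := nrmZ nY (gap k)^-1 (eltsB nY (Yq k.+1) (Yq k.+2)).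
    rewrite -/(v k.+1) ger0_norm ?invr_ge0 ?(ltW (gap_gt0 _))// lee_pdivlMl// => nv.
    have := Kfun_le_r nX 1 (Yv k.+1); rewrite -sum_nrmE mul1e => nsv.
    rewrite (le_trans (lee_wpmul2l _ nsv)) ?lee_fin ?(ltW (gap_gt0 _))//.
    rewrite (le_trans nv)// (le_trans (nrmB nY (Yq _) (Yq _)))//.
    rewrite (le_trans (leeD (nrm_q _) (nrm_q _)))//.
    rewrite -EFinD lee_fin natrX /c !exprS.
    set w := 2 * M * K / B 1; have w0 : 0 <= w by rewrite !mulr_ge0 ?invr_ge0 ?ltW.
    have -> : w / (2 * 2 ^+ k) + w / (2 * (2 * 2 ^+ k)) = 3 * (w / (4 * 2 ^+ k)).
      by field; rewrite gt_eqF.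
    have -> : 4 * w / (2 * (2 * 2 ^+ k)) = 4 * (w / (4 * 2 ^+ k)).
      by field; rewrite gt_eqF.
    by rewrite ler_wpM2r ?ler_nat// divr_ge0// mulr_ge0// ltW.
  - exact: elts_sumr.
  - have sumE n : \sum_(k < n.+1)
        fine (\int[mu]_(s in D `&` kappa @^-1` [set (k : nat)]) (h s)%:E)%E *: v k =
        q 1%N - q n.+1.
      elim: n => [|n IHn]; first by rewrite big_ord1/= scaler0 subrr.
      rewrite big_ord_recr/= IHn massS/= scalerA divff ?gt_eqF// scale1r.
      by rewrite addrA subrK.
    suff cvgS : nrm (sum_space X Y) (\sum_(k < n.+1) fine
        (\int[mu]_(s in D `&` kappa @^-1` [set (k : nat)]) (h s)%:E)%E *: v k - q 1%N)
        @[n --> \oo] --> 0%E.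
      by rewrite -cvg_shiftS; exact: cvgS.
    apply: (@squeeze_cvge _ _ _ _ (cst 0%E) _
      (fun n => (2 * M * K / B 1 / 2 ^+ n.+1)%:E)).
    + apply: nearW => n; apply/andP; split; first exact: (nrm_ge0 nsum).
      rewrite sumE addrAC subrr add0r.
      rewrite (nrmN nsum (elts_sumr nX (Yq _))).
      have := Kfun_le_r nX 1 (Yq n.+1); rewrite -sum_nrmE mul1e => /le_trans; apply.
      exact: nrm_q.
    + exact: cvg_cst.
    + apply/fine_cvgP; split; first exact: nearW.
      have -> : (fine \o (fun n => (2 * M * K / B 1 / 2 ^+ n.+1)%:E)) =
          geometric (2 * M * K / B 1 / 2) (2^-1 : R).
        apply/funext => n /=; rewrite exprS invfM mulrA exprVn; congr (_ / _).
      by apply: cvg_geometric; rewrite ger0_norm// invf_lt1// ltr1n.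
have AJ : (Linfty_norm (fun s => A s * Jfun X Y (u s) s) <= (12 * M)%:E)%E.
  apply: Linfty_norm_le; first by rewrite lee_fin mulr_ge0// ltW.
  apply: ae_lebesgueS2 A_def gdE => s As gds s0.
  have [ds AE] := gds s0; rewrite As// AE.
  apply: (weight_mul_le (g := g s)) => //.
  - by rewrite exprn_gt0// B_gt0.
  - by rewrite mulr_ge0// ltW.
  - exact: Jfun_ge0.
  have [sx _] := kappaP s0.
  have sg : (((12 * M) * (s * h s))%:E <= ((12 * M) * (s * g s))%:E)%E.
    by rewrite lee_fin ler_wpM2l ?mulr_ge0 ?(ltW M_gt0)// ler_wpM2l// ltW.
  apply: le_trans sg; rewrite mulrC EFinM ge_max; apply/andP; split.
    rewrite (le_trans (nrmZ nX _ (Xv _)))// ger0_norm// lee_wpmul2l//.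
    by rewrite lee_fin.
  rewrite (le_trans (lee_wpmul2l _ (nrmZ nY _ (Yv _)))) ?lee_fin ?(ltW s0)//.
  rewrite ger0_norm// muleCA lee_wpmul2l//.
    by rewrite lee_fin.
  exact: nrm_vY.
have Jle : (nrm (J0oo X Y A) (q 1%N) <= (12 * M)%:E)%E.
  by apply: ge_ereal_inf; eexists; [exists u; first exact: repr|exact: AJ].
split => //; split; [exact: elts_sumr|by exists u|].
exact: le_lt_trans Jle (ltry _).
Qed.

End chain.

Variable b : R -> R.
Hypotheses (bB : forall x, 1 <= x -> B x = b x)
  (Boo : forall e : R, 0 < e -> exists2 y : R, 1 <= y & B y < e).

Let N f := Linfty_norm (fun t => (EFin \o b) t * Kfun X Y f t)%E.

Let Kfun_lt f (M x : R) : (N f < M%:E)%E -> 1 <= x ->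
  (Kfun X Y f x < (2 * M / B x)%:E)%E.
Proof.
move=> NM x1; have x0 : 0 < x by exact: lt_le_trans x1.
have Bx0 := B_gt0 x0.
have Bx2 : B x / 2 < B x by rewrite ltr_pdivrMr// ltr_pMr// ltr1n.
have : \forall y \near x, B x / 2 < B y.
  exact: (cvgr_gt _ (AC_pos_continuous acB x0) _ Bx2).
move=> /nbhs_ballP[e /= e0 Be].
have xe : x < x + e by rewrite ltrDl.
(* The bound is known at almost every point; [K(f, .)] is nondecreasing, so a point
   slightly to the right of [x], where [B] is still above half of [B x], suffices. *)
have [s [xs se NK]] := ae_itv_ex xe
  (Linfty_norm_ae (fun t => (EFin \o b) t * Kfun X Y f t)%E).
have s0 : 0 < s by exact: lt_trans xs.
have Bs : B x / 2 < B s.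
  by apply: Be; rewrite /ball/= distrC ger0_norm ?subr_ge0 ?(ltW xs)// ltrBlDl.
have -> : 2 * M / B x = (B x / 2)^-1 * M by rewrite invf_div mulrAC.
rewrite EFinM lte_pdivlMl ?divr_gt0//; apply: le_lt_trans NM.
apply: le_trans (NK s0); apply: le_trans (lee_abs _).
rewrite /= -(bB (le_trans x1 (ltW xs))).
have K0 t : 0 < t -> (0 <= Kfun X Y f t)%E.
  by move=> t0; exact: (nrm_ge0 (Kfun_seminormed nX nY (ltW t0))).
rewrite (@le_trans _ _ ((B s)%:E * Kfun X Y f x)%E)//.
  by rewrite lee_wpmul2r ?K0// lee_fin ltW.
by rewrite lee_wpmul2l ?lee_fin ?(ltW (B_gt0 s0))//; apply: le_Kfun => //; exact: ltW.
Qed.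

(** Any [M] above the norm of [f] gives a decomposition of cost at most a fixed
    multiple of [M]; this includes the case of norm 0, where nearly optimal
    decompositions must be taken relative to a positive bound. *)
Lemma K_space_le_sum_J :
  space_le (K0oo X Y (EFin \o b)) (sum_space X (J0oo X Y A)) (4 / B 1 + 12).
Proof.
have B10 : 0 < B 1 := B_gt0 ltr01.
have /choice[x_ /all_and2[x1 Bx]] : forall k : nat, exists x, 1 <= x /\ B x = B 1 / 2 ^+ k.
  move=> k; have [||x x1 Bx] := level_ex acB ndB Boo (v := B 1 / 2 ^+ k).
  - by rewrite divr_gt0// exprn_gt0.
  - by rewrite ler_pdivrMr ?exprn_gt0// ler_pMr// exprn_ege1// ler1n.
  - by exists x.
move=> f [fE Nf].
have core (M : R) : 0 < M -> (N f < M%:E)%E -> exists p q, [/\ elts X p,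
    elts (J0oo X Y A) q, f = p + q &
    (nrm X p + nrm (J0oo X Y A) q <= ((4 / B 1 + 12) * M)%:E)%E].
  move=> M0 NM.
  have /choice[pq pqP] : forall k, exists pq : Z * Z, [/\ elts X pq.1, elts Y pq.2,
      f = pq.1 + pq.2 & (nrm X pq.1 + (x_ k)%:E * nrm Y pq.2 <=
        (2 * M * 2 ^+ k / B 1)%:E)%E].
    move=> k; have /ereal_inf_lt[_ [pq /= [Xp Yq fpq] <-] /ltW le] := Kfun_lt NM (x1 k).
    exists pq; split => //; apply: (le_trans le); rewrite Bx lee_fin le_eqVlt.
    by apply/orP; left; apply/eqP; field; rewrite !gt_eqF ?exprn_gt0.
  have pqX k : elts X (pq k).1 by case: (pqP k).
  have pqY k : elts Y (pq k).2 by case: (pqP k).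
  have pqE k : f = (pq k).1 + (pq k).2 by case: (pqP k).
  have pq_le k : (nrm X (pq k).1 + (x_ k)%:E * nrm Y (pq k).2 <=
      (2 * M * 2 ^+ k / B 1)%:E)%E by case: (pqP k).
  have [Jq Jle] := chain_J_space M0 x1 Bx pqX pqY pqE pq_le.
  have [Xp Yq fpq le] := pqP 1%N.
  exists (pq 1%N).1, (pq 1%N).2; split => //.
  rewrite mulrDl EFinD leeD//.
  have -> : 4 / B 1 * M = 2 * M * 2 ^+ 1 / B 1 by field; rewrite gt_eqF.
  apply: le_trans le; rewrite leeDl// mule_ge0 ?(nrm_ge0 nY)//.
  by rewrite lee_fin (le_trans _ (x1 _)).
have N0 : (0 <= N f)%E := Linfty_norm_ge0 _.
have Nfin : N f \is a fin_num by rewrite ge0_fin_numE.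
split.
  have [|p [q [Xp Jq fpq _]]] := core (fine (N f) + 1) (ltr_wpDl (fine_ge0 N0) ltr01).
    by rewrite EFinD fineK// lteDl// lte_fin.
  by exists (p, q).
have C0 : 0 < 4 / B 1 + 12 by rewrite addr_gt0// divr_gt0.
apply/lee_addgt0Pr => e e0.
have [||p [q [Xp Jq fpq le]]] := core (fine (N f) + e / (4 / B 1 + 12)).
- by rewrite ltr_wpDl ?fine_ge0// divr_gt0.
- by rewrite EFinD fineK// lteDl// lte_fin divr_gt0.
rewrite /= mem_set// -/(N f).
apply: ge_ereal_inf; exists (nrm X p + nrm (J0oo X Y A) q)%E; first by exists (p, q).
apply: (le_trans le).
rewrite mulrDr mulrCA divff ?gt_eqF// mulr1 EFinD EFinM fineK//.
Qed.

End K_into_sum_J.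

(** * The two equivalences *)

Section monotone_weights.
Set Implicit Arguments.
Unset Strict Implicit.
Context {R : realType}.

Lemma decreasing_nonincreasing_pos (f : R -> R) :
  decreasing_pos f -> nonincreasing_pos f.
Proof.
by move=> df x y x0; rewrite le_eqVlt => /predU1P[->//|xy]; exact/ltW/df.
Qed.

Lemma nonincreasing_pos_bounded (f : R -> R) : nonincreasing_pos f ->
  cvg (f x @[x --> 0^'+]) -> exists C, forall t, 0 < t -> f t <= C.
Proof.
move=> ndf f0; set l := lim (f x @[x --> 0^'+]).
have near_lt : \forall t \near 0^'+, f t < l + 1 by apply: (cvgr_lt l); rewrite ?ltrDl.
exists (l + 1) => t t0.
have [s [s0 st fs]] : exists s, [/\ 0 < s, s <= t & f s < l + 1].
  apply: (@filter_ex _ (0^'+ : set_system R)); near=> s; split.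
  - by near: s; exact: nbhs_right_gt.
  - by near: s; exact: nbhs_right_le.
  - by near: s.
exact: le_trans (ndf _ _ s0 st) (ltW fs).
Unshelve. all: by end_near. Qed.

Lemma cvg0_small (f : R -> R) : f x @[x --> +oo] --> 0 ->
  forall e, 0 < e -> exists2 y : R, 1 <= y & f y < e.
Proof.
move=> f0 e e0.
have [y [y1 fy]] : exists y : R, 1 <= y /\ f y < e.
  apply: (@filter_ex _ (+oo : set_system R)); near=> y; split; near: y.
  - exact: nbhs_pinfty_ge.
  - exact: (cvgr_lt 0).
by exists y.
Unshelve. all: by end_near. Qed.

(** The pieces [c * beta] and [b] are monotone, and continuity at 1 excludes an
    upward jump there. *)
Lemma glued_nonincreasing (b beta B : R -> R) (c : R) :
  nonincreasing_pos b -> nonincreasing_pos beta -> 0 < c -> AC_pos B ->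
  (forall x, 1 <= x -> B x = b x) ->
  (forall x, 0 < x -> x < 1 -> B x = c * beta x) -> nonincreasing_pos B.
Proof.
move=> ndb ndbeta c0 acB B_ge1 B_lt1.
have left1 x : 0 < x -> x < 1 -> B 1 <= B x.
  move=> x0 x1; rewrite leNgt; apply/negP => BxB1.
  have near_gt : \forall z \near 1^'-, B x < B z.
    apply: (cvgr_gt (B 1)) => //; apply: cvg_at_left_filter.
    exact: AC_pos_continuous.
  have [z [xz z1 Bz]] : exists z, [/\ x < z, z < 1 & B x < B z].
    apply: (@filter_ex _ (1^'- : set_system R)); near=> z; split.
    - by near: z; exact: nbhs_left_gt.
    - by near: z; exact: nbhs_left_lt.
    - by near: z.
  move: Bz; rewrite (B_lt1 _ x0 x1) (B_lt1 _ (lt_trans x0 xz) z1) ltr_pM2l// ltNge.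
  move=> /negP; apply.
  by apply: ndbeta => //; exact: ltW.
move=> x y x0 xy; have [x1|x1] := leP 1 x.
  by rewrite !B_ge1 ?(le_trans x1)//; apply: ndb.
have [y1|y1] := leP 1 y.
  apply: le_trans (left1 x x0 x1); rewrite !B_ge1//; exact: ndb.
have y0 : 0 < y by exact: lt_le_trans xy.
by rewrite (B_lt1 _ x0 x1) (B_lt1 _ y0 y1) ler_pM2l//; exact: ndbeta.
Unshelve. all: by end_near. Qed.

End monotone_weights.

Theorem corollary1p21 (R : realType) (Z : topologicalLmodType R)
  (X0 X1 : completeNormedModType R)
  (i0 : {linear X0 -> Z}) (i1 : {linear X1 -> Z})
  (X_compat : compatible_couple i0 i1)
  (b : R -> R) (b_SV : SV b) (b_AC : AC_pos b)
  (b_decr : decreasing_pos b)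
  (b_at0 : cvg (b x @[x --> 0^'+]))
  (b_atoo : b x @[x --> +oo] --> 0)
  (beta : R -> R) (beta_SV : SV beta) (beta_AC : AC_pos beta)
  (beta_decr : decreasing_pos beta)
  (beta_at0 : beta x @[x --> 0^'+] --> +oo)
  (beta_atoo : beta x @[x --> +oo] --> 0)
  (c : R) (c_gt0 : 0 < c)
  (B : R -> R) (B_SV : SV B) (B_AC : AC_pos B)
  (B_ge1 : forall x : R, 1 <= x -> B x = b x)
  (B_lt1 : forall x : R, 0 < x -> x < 1 -> B x = c * beta x)
  (A : R -> \bar R)
  (A_def : {ae lebesgue_measure, forall x : R, 0 < x -> A x = J_weight B x}) :
  let E0 := embedded i0 in
  let E1 := embedded i1 in
  eq_space (K0oo E0 E1 (EFin \o b))
           (sum_space E0 (K0oo E0 E1 (EFin \o B))) /\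
  eq_space (sum_space E0 (K0oo E0 E1 (EFin \o B)))
           (sum_space E0 (J0oo E0 E1 A)).
Proof.
move=> E0 E1.
have nE0 : seminormed E0 := embedded_seminormed i0.
have nE1 : seminormed E1 := embedded_seminormed i1.
have [b_gt0 _ _] := b_SV; have [B_gt0 _ _] := B_SV.
have ndb := decreasing_nonincreasing_pos b_decr.
have ndB : nonincreasing_pos B.
  exact: glued_nonincreasing ndb (decreasing_nonincreasing_pos beta_decr) c_gt0 B_AC _ B_lt1.
have [K K_gt0 B_sqr] := SV_sqr_le B_SV.
have B_small e : 0 < e -> exists2 y : R, 1 <= y & B y < e.
  by move=> /(cvg0_small b_atoo)[y y1 by_lt]; exists y => //; rewrite B_ge1.
have B1_gt0 : 0 < B 1 by exact: B_gt0.
have [C0 b_le] := nonincreasing_pos_bounded ndb b_at0.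
have C0_gt0 : 0 < C0 by exact: lt_le_trans (b_gt0 1 ltr01) (b_le 1 ltr01).
pose C := C0 + C0 / B 1 + 1.
have C0C : C0 <= C by rewrite /C -addrA lerDl addr_ge0// divr_ge0// ltW.
have C_gt0 : 0 < C by exact: lt_le_trans C0C.
have bB t : 0 < t -> b t <= C * B t.
  move=> t0; have [t1|t1] := leP 1 t.
    rewrite B_ge1// ler_peMl ?(ltW (b_gt0 _ t0))// /C lerDr addr_ge0 ?divr_ge0//; exact: ltW.
  apply: (le_trans (b_le _ t0)); apply: (@le_trans _ _ (C0 / B 1 * B t)).
    rewrite mulrAC ler_pdivlMr// ler_pM2l//; apply: ndB => //; exact: ltW.
  rewrite ler_pM2r ?B_gt0// /C addrAC lerDr addr_ge0//; exact: ltW.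
have b_ge0 t : 0 < t -> 0 <= b t by move=> /b_gt0/ltW.
have B_ge0 t : 0 < t -> 0 <= B t by move=> /B_gt0/ltW.
have b_leC t : 0 < t -> b t <= C by move=> /b_le/le_trans; apply.
have K_sumJ : space_le (K0oo E0 E1 (EFin \o b)) (sum_space E0 (J0oo E0 E1 A)) (4 / B 1 + 12).
  exact: (K_space_le_sum_J nE0 nE1 B_gt0 ndB B_AC K_gt0 B_sqr A_def B_ge1 B_small).
have sumJ_sumK : space_le (sum_space E0 (J0oo E0 E1 A))
    (sum_space E0 (K0oo E0 E1 (EFin \o B))) (1 + K).
  apply: sum_space_le; first by rewrite lerDl ltW.
  - exact: (nrm_ge0 nE0).
  - by move=> f; apply/ereal_infP => _ [u _ <-]; exact: Linfty_norm_ge0.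
  - exact: (J_space_le_K nE0 nE1 B_gt0 ndB B_AC K_gt0 B_sqr A_def).
have sumK_K : space_le (sum_space E0 (K0oo E0 E1 (EFin \o B))) (K0oo E0 E1 (EFin \o b)) C.
  exact: (sum_K_space_le_K nE0 nE1 b_ge0 B_ge0 b_leC bB C_gt0).
have K1_gt0 : 0 < 1 + K by rewrite addr_gt0.
have D_gt0 : 0 < 4 / B 1 + 12 by rewrite addr_gt0// divr_gt0.
split.
- apply: (eq_space_le (C := (1 + K) * (4 / B 1 + 12)) (D := C)) => //.
    exact: mulr_gt0.
  exact: space_le_trans (ltW K1_gt0) K_sumJ sumJ_sumK.
- apply: (eq_space_le (C := (4 / B 1 + 12) * C) (D := 1 + K)) => //.
    exact: mulr_gt0.
  exact: space_le_trans (ltW D_gt0) sumK_K K_sumJ.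
Qed.
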